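(* (Coercivity identity) Let $\phi$ be a pair potential on $\mathbb{R}^d$ with $\phi(x)\ge0$ for all $x\in\mathbb{R}^d$ and $\int_{\mathbb{R}^d}|1-e^{-\phi(x)}|\,dx<\infty$, let $z>0$ and $\mu\in\mathcal{G}(z,\phi)$. Then, for any $F\in\mathcal{F}C_b^\infty(\mathcal{D},\Gamma)$, $$\int_\Gamma(HF(\gamma))^2\,\mu(d\gamma)=\int_\Gamma\bigg[\operatorname{Tr}\,(D^-)^2F(\gamma)\,((D^-)^2F(\gamma))^*+\sum_{x,y\in\gamma,\,x\ne y}(\exp[\phi(x-y)]-1)\,(F(\gamma\setminus\{x,y\})-F(\gamma\setminus x))\,(F(\gamma\setminus\{x,y\})-F(\gamma\setminus y))\bigg]\mu(d\gamma).$$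
   Context: Configuration space. $\Gamma$ is the set of all locally finite subsets $\gamma\subset\mathbb{R}^d$, $d\in\mathbb{N}$; $\gamma$ is identified with the Radon measure $\sum_{x\in\gamma}\varepsilon_x$, and $\langle f,\gamma\rangle:=\sum_{x\in\gamma}f(x)$. $\Gamma$ carries the vague topology (weakest topology making $\gamma\mapsto\langle f,\gamma\rangle$ continuous for all $f\in\mathcal{D}:=C_0(\mathbb{R}^d)$, the continuous real functions with compact support) and its Borel $\sigma$-algebra $\mathcal{B}(\Gamma)$. We write $x$ for $\{x\}$. Gibbs measures. A pair potential is a Borel function $\phi:\mathbb{R}^d\to\mathbb{R}\cup\{+\infty\}$ with $\phi(-x)=\phi(x)\in\mathbb{R}$ for $x\ne0$. For $x\notin\gamma$, $E(x,\gamma):=\sum_{y\in\gamma}\phi(x-y)$ if $\sum_{y\in\gamma}|\phi(x-y)|<\infty$ and $+\infty$ otherwise. For $z>0$, $\mathcal{G}(z,\phi)$ is the set of probability measures $\mu$ on $(\Gamma,\mathcal{B}(\Gamma))$ with $$\int_\Gamma\mu(d\gamma)\int_{\mathbb{R}^d}\gamma(dx)F(\gamma,x)=\int_\Gamma\mu(d\gamma)\int_{\mathbb{R}^d}z\,dx\,e^{-E(x,\gamma)}F(\gamma\cup x,x)$$ for all measurable $F:\Gamma\times\mathbb{R}^d\to[0,+\infty]$. Operators. $\mathcal{F}C_b^\infty(\mathcal{D},\Gamma)$ is the set of functions $F(\gamma)=g_F(\langle\varphi_1,\gamma\rangle,\dots,\langle\varphi_N,\gamma\rangle)$, $N\in\mathbb{N}$,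 $\varphi_i\in\mathcal{D}$, $g_F\in C_b^\infty(\mathbb{R}^N)$ (smooth, bounded together with all derivatives). $D^-_xF(\gamma):=F(\gamma\setminus x)-F(\gamma)$, $D^+_xF(\gamma):=F(\gamma)-F(\gamma\cup x)$, and $$HF(\gamma)=\int_{\mathbb{R}^d}z\,dx\,e^{-E(x,\gamma)}D^+_xF(\gamma)-\int_{\mathbb{R}^d}\gamma(dx)D^-_xF(\gamma).$$ Put $T_\gamma:=L^2(\mathbb{R}^d,\gamma)$. $(D^-)^2F(\gamma)$ is the element of $T_\gamma^{\otimes2}=L^2((\mathbb{R}^d)^2,\gamma^{\otimes2})$ given by $(x,y)\mapsto D^-_xD^-_yF(\gamma)$; for $x,y\in\gamma$, $D^-_xD^-_yF(\gamma)=F(\gamma\setminus\{x,y\})-F(\gamma\setminus x)-F(\gamma\setminus y)+F(\gamma)$ if $x\ne y$, and $D^-_xD^-_xF(\gamma)=F(\gamma)-F(\gamma\setminus x)$. Elements of $T_\gamma^{\otimes2}$ are identified with (Hilbert–Schmidt) operators in $T_\gamma$, so that $\operatorname{Tr}(D^-)^2F(\gamma)((D^-)^2F(\gamma))^*=\sum_{x,y\in\gamma}(D^-_xD^-_yF(\gamma))^2$ (the sum including $x=y$). *)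

(* Defs.v *)
From HB Require Import structures.
From mathcomp Require Import all_boot all_order all_algebra.
From mathcomp Require Import all_classical all_reals all_analysis.
From mathcomp Require Import measurable_realfun lra.

Set Implicit Arguments.
Unset Strict Implicit.
Unset Printing Implicit Defensive.
Import Order.TTheory GRing.Theory Num.Theory.
Import numFieldNormedType.Exports.

Local Open Scope classical_set_scope.
Local Open Scope ring_scope.

Definition borel_rV_display : measure_display -> measure_display.
Proof. exact. Qed.

Section borel_rV.
Context {R : realType} {d : nat}.

HB.instance Definition _ := @isMeasurable.Build
  (borel_rV_display default_measure_display) 'rV[R]_d
  <<s @open 'rV[R]_d >>
  (@sigma_algebra0 _ setT _) (@sigma_algebraC _ _)
  (@sigma_algebra_bigcup _ setT _).

Lemma open_measurable_rV (U : set 'rV[R]_d) : open U -> measurable U.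
Proof. by move=> oU; exact: sub_sigma_algebra. Qed.

End borel_rV.

(* The library's sigma-finite instance for products is shadowed by the one for
   subprobabilities, hence this alias. *)
Section sf_product.
Context d1 d2 (T1 : measurableType d1) (T2 : measurableType d2) (R : realType).
Variable m1 : {sigma_finite_measure set T1 -> \bar R}.
Variable m2 : {sigma_finite_measure set T2 -> \bar R}.

Definition sf_product : set (T1 * T2) -> \bar R := (m1 \x m2)%E.

HB.instance Definition _ := Measure.on sf_product.

Let sf_product_sigma_finite : sigma_finite [set: T1 * T2] sf_product.
Proof.
have /sigma_finiteP[F [TF ndF Foo]] := sigma_finiteT m1.
have /sigma_finiteP[G [TG ndG Goo]] := sigma_finiteT m2.
exists (fun n => F n `*` G n).
  rewrite -setXTT TF TG predeqE => -[x y]; split.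
    move=> [/= [n _ Fnx] [k _ Gky]]; exists (maxn n k) => //; split.
    - by move: x Fnx; exact/subsetPset/ndF/leq_maxl.
    - by move: y Gky; exact/subsetPset/ndG/leq_maxr.
  by move=> [n _ []/= ? ?]; split; exists n.
move=> k; have [? ?] := Foo k; have [? ?] := Goo k.
split; first exact: measurableX.
by rewrite /sf_product product_measure1E// lte_mul_pinfty// ge0_fin_numE.
Qed.

HB.instance Definition _ := Measure_isSigmaFinite.Build _ _ _ sf_product
  sf_product_sigma_finite.

End sf_product.

(* The left inverse g is used only to transport sigma-finiteness along f. *)
Section pushforward_iso.
Context d1 d2 (T1 : measurableType d1) (T2 : measurableType d2) (R : realType).
Variables (m : {sigma_finite_measure set T1 -> \bar R}).
Variables (f : T1 -> T2) (g : T2 -> T1).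
Hypotheses (mf : measurable_fun [set: T1] f) (mg : measurable_fun [set: T2] g).
Hypothesis fK : cancel f g.

Definition pushforward_iso
  of measurable_fun [set: T1] f & measurable_fun [set: T2] g & cancel f g :=
  pushforward m f.

Local Notation mu := (pushforward_iso mf mg fK).

Let mu0 : mu set0 = 0%E.
Proof. by rewrite /pushforward_iso /pushforward preimage_set0 measure0. Qed.

Let mu_ge0 A : (0 <= mu A)%E.
Proof. exact: measure_ge0. Qed.

Let mu_sigma_additive : semi_sigma_additive mu.
Proof.
move=> F mF tF mUF; rewrite /pushforward_iso /pushforward preimage_bigcup.
apply: measure_semi_sigma_additive.
- by move=> n; rewrite -[X in measurable X]setTI; exact: mf.
- apply/trivIsetP => /= i j _ _ ij; rewrite -preimage_setI.
  by move/trivIsetP : tF => /(_ _ _ _ _ ij) ->//; rewrite preimage_set0.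
- by rewrite -preimage_bigcup -[X in measurable X]setTI; exact: mf.
Qed.

HB.instance Definition _ := isMeasure.Build _ _ _ mu
  mu0 mu_ge0 mu_sigma_additive.

Let mu_sigma_finite : sigma_finite [set: T2] mu.
Proof.
have [F TF mF] := sigma_finiteT m.
exists (fun n => g @^-1` F n); first by rewrite -preimage_bigcup -TF.
move=> n; have [mFn Fnoo] := mF n; split.
  by rewrite -[X in measurable X]setTI; exact: mg.
rewrite /pushforward_iso /pushforward -comp_preimage.
by rewrite (_ : g \o f = id)//; exact/funext.
Qed.

HB.instance Definition _ := Measure_isSigmaFinite.Build _ _ _ mu
  mu_sigma_finite.

End pushforward_iso.

Section lebesgue_rV.
Context {R : realType}.
Local Notation RR := (measurableTypeR R).

Definition tuple_cons n (p : RR * n.-tuple RR) : n.+1.-tuple RR :=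
  [tuple of p.1 :: p.2].

Definition tuple_uncons n (t : n.+1.-tuple RR) : RR * n.-tuple RR :=
  (thead t, [tuple of behead t]).

Lemma tuple_consK n : cancel (@tuple_cons n) (@tuple_uncons n).
Proof. by case=> x t; congr pair; apply/val_inj. Qed.

Lemma measurable_tuple_cons n : measurable_fun setT (@tuple_cons n).
Proof. exact: measurable_cons. Qed.

Lemma measurable_tuple_uncons n : measurable_fun setT (@tuple_uncons n).
Proof.
apply/measurable_fun_pair; last exact: measurable_behead.
exact: measurable_tnth.
Qed.

Fixpoint lebesgue_tuple n : {sigma_finite_measure set (n.-tuple RR) -> \bar R} :=
  if n is n'.+1 then
    pushforward_iso (sf_product lebesgue_measure (lebesgue_tuple n'))
      (@measurable_tuple_cons n') (@measurable_tuple_uncons n')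
      (@tuple_consK n')
  else \d_[tuple].

Definition row_of_tuple n (t : n.-tuple RR) : 'rV[R]_n := \row_i tnth t i.
Definition tuple_of_row n (v : 'rV[R]_n) : n.-tuple RR := [tuple v ord0 i | i < n].

Lemma row_of_tupleK n : cancel (@row_of_tuple n) (@tuple_of_row n).
Proof. by move=> t; apply/eq_from_tnth => i; rewrite tnth_mktuple mxE. Qed.

Let open_rV_measurable n (U : set 'rV[R]_n) :
  open U -> measurable (@row_of_tuple n @^-1` U).
Proof.
move=> oU.
pose B (p : 'rV[rat]_n * nat) : set 'rV[R]_n :=
  [set v | forall i, v ord0 i \in `](ratr (p.1 ord0 i) - p.2.+1%:R^-1 : R),
                                     (ratr (p.1 ord0 i) + p.2.+1%:R^-1 : R)[ ].
have -> : U = \bigcup_(p in [set p | B p `<=` U]) B p.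
  rewrite eqEsubset; split => [v Uv|v [p /= pU pv]]; last exact: pU.
  have /nbhs_ballP[e /= e0 eU] : nbhs v U by exact: open_nbhs_nbhs.
  have e20 : 0 < e / 2 by rewrite divr_gt0.
  have [k _ ke] := near_infty_natSinv_lt (PosNum e20).
  have k0 : (0 : R) < k.+1%:R^-1 by rewrite invr_gt0.
  have /choice[q qv] : forall i, exists q : rat,
      v ord0 i \in `](ratr q - k.+1%:R^-1 : R), (ratr q + k.+1%:R^-1 : R)[.
    move=> i; have [|q] := @rat_in_itvoo R (v ord0 i) (v ord0 i + k.+1%:R^-1).
      by rewrite ltrDl.
    rewrite in_itv/= => /andP[vq qv]; exists q.
    by rewrite in_itv/= ltrBlDr qv/= (lt_trans vq)// ltrDl.
  exists (\row_i q i, k); last by move=> i; rewrite /= mxE.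
  move=> w /= wB; apply: eU; split => // a b; rewrite (ord1 a : a = ord0).
  have := wB b; have := qv b; rewrite mxE !in_itv/= => /andP[v1 v2] /andP[w1 w2].
  have /= ke2 := ke k (leqnn k).
  rewrite /ball/= ltr_norml.
  move: (v ord0 b) (w ord0 b) (ratr (q b) : R) (k.+1%:R^-1) v1 v2 w1 w2 ke2.
  by move=> x y z u *; apply/andP; split; lra.
rewrite preimage_bigcup bigcup_mkcond.
apply: countable_bigcupT_measurable => // p; case: ifPn => // _.
rewrite (_ : _ @^-1` _ = \bigcap_(i in [set: 'I_n])
    (fun t : n.-tuple RR => tnth t i) @^-1`
    `](ratr (p.1 ord0 i) - p.2.+1%:R^-1 : R),
      (ratr (p.1 ord0 i) + p.2.+1%:R^-1 : R)[); last first.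
  rewrite eqEsubset; split => [t tB i _|t tB i]; first by have := tB i; rewrite mxE.
  by rewrite mxE; exact: tB.
apply: fin_bigcap_measurable => // i _.
rewrite -[X in measurable X]setTI.
by apply: measurable_tnth => //; exact: measurable_itv.
Qed.

Lemma measurable_row_of_tuple n : measurable_fun setT (@row_of_tuple n).
Proof.
move=> _ A mA; rewrite setTI; move: A mA; apply: smallest_sub.
  split=> [|A mA|F mF] /=.
  - by rewrite preimage_set0.
  - by rewrite setTD preimage_setC; exact: measurableC.
  - by rewrite preimage_bigcup; exact: bigcup_measurable.
exact: open_rV_measurable.
Qed.

Lemma measurable_tuple_of_row n : measurable_fun setT (@tuple_of_row n).
Proof.
apply/measurable_fun_tnthP => i.
apply: (measurability _ (RGenOpens.measurableE R)) => _ [_ [a [b ->] <-]].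
rewrite setTI; apply: open_measurable_rV.
rewrite (_ : _ \o _ = fun v : 'rV[R]_n => v ord0 i).
  by apply: open_comp => [v _|]; [exact: coord_continuous|exact: interval_open].
by apply/funext => v /=; rewrite tnth_mktuple.
Qed.

Definition lebesgue_rV n : {sigma_finite_measure set 'rV[R]_n -> \bar R} :=
  pushforward_iso (lebesgue_tuple n) (@measurable_row_of_tuple n)
    (@measurable_tuple_of_row n) (@row_of_tupleK n).

Lemma lebesgue_tuple_prod n (A : 'I_n -> set RR) :
  (forall i, measurable (A i)) ->
  lebesgue_tuple n [set t | forall i, A i (tnth t i)] =
  (\prod_(i < n) lebesgue_measure (A i))%E.
Proof.
elim: n A => [|n ih] A mA.
  by rewrite big_ord0 /= diracE mem_set//= => -[].
rewrite big_ord_recl /= /pushforward_iso /pushforward /sf_product.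
rewrite (_ : _ @^-1` _ = A ord0 `*`
    [set t : n.-tuple RR | forall i, A (lift ord0 i) (tnth t i)]); last first.
  rewrite eqEsubset; split => [[x t] /= At|[x t] /= [Ax At] i].
    split=> [|i]; first exact: At ord0.
    by have := At (lift ord0 i); rewrite tnthS.
  by case: (unliftP ord0 i) => [j ->|->//]; rewrite tnthS; exact: At.
rewrite product_measure1E//; first by congr (_ * _)%E; exact: ih.
rewrite (_ : [set t | _] = \bigcap_(i in [set: 'I_n])
    (fun t : n.-tuple RR => tnth t i) @^-1` A (lift ord0 i)); last first.
  by rewrite eqEsubset; split => [t At i _|t At i]; exact: At.
apply: fin_bigcap_measurable => // i _.
by rewrite -[X in measurable X]setTI; exact: measurable_tnth.
Qed.

Lemma lebesgue_rV_prod n (A : 'I_n -> set RR) :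
  (forall i, measurable (A i)) ->
  lebesgue_rV n [set v | forall i, A i (v ord0 i)] =
  (\prod_(i < n) lebesgue_measure (A i))%E.
Proof.
move=> mA; rewrite -lebesgue_tuple_prod// /lebesgue_rV /= /pushforward_iso.
rewrite /pushforward; congr (lebesgue_tuple n _).
by rewrite eqEsubset; split => t At i; have := At i; rewrite mxE.
Qed.

End lebesgue_rV.

Section configuration_space.
Variables (R : realType) (d : nat).
Local Notation X := 'rV[R]_d.

Definition locally_finite (g : set X) :=
  forall K : set X, compact K -> finite_set (g `&` K).

Record config := Config {
  config_set :> set X ;
  config_locally_finite : locally_finite config_set }.

HB.instance Definition _ := gen_eqMixin config.
HB.instance Definition _ := gen_choiceMixin config.

Lemma locally_finite0 : locally_finite set0.
Proof. by move=> K _; rewrite set0I. Qed.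

HB.instance Definition _ := isPointed.Build config (Config locally_finite0).

Lemma locally_finiteU1 (x : X) (g : config) : locally_finite (x |` g).
Proof.
move=> K cK; rewrite setIUl finite_setU; split.
  by apply: (sub_finite_set (@subIsetl _ _ _)); exact: finite_set1.
exact: config_locally_finite.
Qed.

Lemma locally_finiteD (g : config) (A : set X) : locally_finite (g `\` A).
Proof.
move=> K cK; apply: (sub_finite_set _ (config_locally_finite g cK)).
by move=> y [[]].
Qed.

Definition config_add (x : X) (g : config) : config :=
  Config (@locally_finiteU1 x g).

Definition config_del (g : config) (A : set X) : config :=
  Config (@locally_finiteD g A).

Definition test_function (f : X -> R) :=
  continuous f /\ compact (closure [set x | f x != 0]).

(* <f, g>. The sum has finite support when f is a test function; \sum_(_ \in _)
   is 0 when the support is infinite. *)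
Definition pairing (f : X -> R) (g : config) : R := \sum_(x \in g) f x.

(* The vague topology: the weakest one making pairing f continuous for every
   test function f. *)
HB.instance Definition _ := @isSubBaseTopological.Build config
  ((X -> R) * set R)%type
  [set fU | test_function fU.1 /\ open fU.2]
  (fun fU => pairing fU.1 @^-1` fU.2).

End configuration_space.

Definition borel_config_display : measure_display -> measure_display.
Proof. exact. Qed.

HB.instance Definition _ (R : realType) (d : nat) := @isMeasurable.Build
  (borel_config_display default_measure_display) (config R d)
  <<s @open (config R d) >>
  (@sigma_algebra0 _ setT _) (@sigma_algebraC _ _)
  (@sigma_algebra_bigcup _ setT _).

Section smooth_cylinder_functions.
Context {R : realType}.

Definition partials N (s : seq 'I_N) (h : 'rV[R]_N -> R) : 'rV[R]_N -> R :=
  foldr (fun i k x => 'D_(delta_mx ord0 i) k x) h s.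

Definition Cb_infty N (h : 'rV[R]_N -> R) := forall s : seq 'I_N,
  [/\ continuous (partials s h),
      forall i x, derivable (partials s h) x (delta_mx ord0 i) &
      exists M : R, forall x, `|partials s h x| <= M].

Definition FCb_infty d : set (config R d -> R) :=
  [set F | exists N (h : 'rV[R]_N -> R) (f : 'I_N -> 'rV[R]_d -> R),
    [/\ (0 < N)%N, Cb_infty h, (forall i, test_function (f i)) &
        F = fun g => h (\row_i pairing (f i) g)]].

End smooth_cylinder_functions.

(* Integral of f against the sum of the unit masses at the points of D; esum
   alone is only meaningful for nonnegative functions. *)
Definition ssum {R : realType} {T : choiceType} (D : set T) (f : T -> \bar R) :
    \bar R :=
  (\esum_(x in D) f^\+ x - \esum_(x in D) f^\- x)%E.

Section gibbs_measures.
Context {R : realType} {d : nat}.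
Local Notation X := 'rV[R]_d.
Implicit Types (phi : X -> \bar R) (g : config R d) (F : config R d -> R).
Local Open Scope ereal_scope.

Definition pair_potential phi :=
  [/\ measurable_fun setT phi,
      forall x, phi x != -oo,
      forall x, phi (- x)%R = phi x &
      forall x, x != 0%R -> phi x \is a fin_num].

(* Also defined for x in g, which for 0 < d is a Lebesgue-null set of x. *)
Definition energy phi (x : X) g : \bar R :=
  if `[< summable g (fun y => phi (x - y)%R) >]
  then ssum g (fun y => phi (x - y)%R) else +oo.

Definition gibbs (z : R) phi : set (probability (config R d) R) :=
  [set mu : probability (config R d) R | forall F : config R d * X -> \bar R,
    measurable_fun setT F -> (forall gx, 0 <= F gx) ->
    \int[mu]_g (\esum_(x in g) F (g, x)) =
    \int[mu]_g \int[lebesgue_rV d]_x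
      (z%:E * expeR (- energy phi x g) * F (config_add x g, x))].

Definition Dminus (x : X) F g : R := (F (config_del g [set x]) - F g)%R.

Definition Dplus (x : X) F g : R := (F g - F (config_add x g))%R.

Definition generatorH (z : R) phi F g : \bar R :=
  \int[lebesgue_rV d]_x
    (z%:E * expeR (- energy phi x g) * (Dplus x F g)%:E)
  - ssum g (fun x => (Dminus x F g)%:E).

Definition Dminus2 F g (x y : X) : \bar R := (Dminus x (Dminus y F) g)%:E.

End gibbs_measures.

(* Operators on L^2(g) given by their kernels. Since g is a sum of unit masses,
   the indicators of its points form an orthonormal basis, and the kernel is
   the matrix of the operator in that basis. *)
Section kernel_operators.
Context {R : realType} {d : nat}.
Local Notation X := 'rV[R]_d.
Implicit Types (g : config R d) (K L : X -> X -> \bar R).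

Definition op_adjoint K : X -> X -> \bar R := fun x y => K y x.

Definition op_comp g K L : X -> X -> \bar R :=
  fun x y => ssum g (fun w => K x w * L w y)%E.

Definition op_trace g K : \bar R := ssum g (fun x => K x x).

End kernel_operators.

(* Main.v *)
(* Write B = \sum_(x in g) D^-_x F and A = \int z e^{-E(x,g)} D^+_x F dx, so that
   HF = A - B. As sums over the finitely many points of g in a box carrying
   the test functions, the two integrands differ, pointwise in g, by
   A^2 - 2 A B + 2 S1 - S3 with
     S1 = \sum_(x <> y) D^-_x F(g) (F(g \ {x,y}) - F(g \ x)),
     S3 = \sum_(x <> y) e^{phi(x-y)} (F(g \ {x,y}) - F(g \ y)) (F(g \ {x,y}) - F(g \ x)).
   The Gibbs identity, used once, gives E[S1] = E[A B]. Used for S3 and then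
   for S2 = \sum_(y in g) D^-_y F(g) A(g \ y), it gives E[S3] = E[S2] = E[A^2],
   because e^{-E(x,g)} e^{phi(x-y)} = e^{-E(x, g \ y)} for y in g. Nonnegativity of phi
   bounds the intensity by z, hence the number of points in a box has a second
   moment and every term is integrable. *)
From HB Require Import structures.
Require Import Defs.
From mathcomp Require Import all_boot all_order all_algebra finmap.
From mathcomp Require Import all_classical all_reals all_analysis.
From mathcomp Require Import measurable_realfun ring lra.

Set Implicit Arguments.
Unset Strict Implicit.
Unset Printing Implicit Defensive.
Import Order.TTheory GRing.Theory Num.Theory.
Import numFieldNormedType.Exports.

Local Open Scope classical_set_scope.
Local Open Scope ring_scope.

(** * Borel and Lebesgue structure of row vectors *)

Section row_vectors.
Context {R : realType}.

(** The obstacle behind most of the preparation is joint measurability: [config_add] and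
    [config_del] are never shown to be measurable in [(g, x)]. A cylinder function sees [g] only
    through the vector [pairings g], and adding [x] shifts this vector by [tests x]; all integrands
    are therefore rewritten with such shifts, which are measurable in [(g, x)]. The formulas for an
    added point hold for [x] outside [g], which is enough because [g] is countable and so
    Lebesgue-null. Sums over [g] are measurable because they are integrals against a counting
    measure depending measurably on [g]. The other obstacle is that e^phi is unbounded. In S3 the
    Gibbs identity puts e^{-E(x,g)} next to it, and for [y] in [g] this is at most e^{-phi(x-y)}, so
    the product is at most 1. *)

Lemma coord_norm_le n (v : 'rV[R]_n) i : `|v ord0 i| <= `|v|.
Proof.
rewrite [leRHS]/Num.norm /= mx_normrE; apply/bigmax_geP; right => /=.
by exists (ord0, i).
Qed.

Definition box n (r : R) : set 'rV[R]_n := [set v | `|v| <= r].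

Lemma compact_box n r : compact (@box n r).
Proof.
apply: bounded_closed_compact.
  by exists r; split; [exact: num_real|move=> M rM v /= /le_trans; apply; exact: ltW].
rewrite (_ : box r = (fun v => `|v|) @^-1` [set x | x <= r])//.
apply: closed_comp; last exact: closed_le.
by move=> v _; exact: norm_continuous.
Qed.

Lemma measurable_box n r : measurable (@box n r).
Proof.
rewrite -[X in measurable X]setCK; apply: measurableC; apply: open_measurable_rV.
apply: closed_openC; apply: compact_closed; last exact: compact_box.
exact: norm_hausdorff.
Qed.

Lemma lebesgue_box n r : (lebesgue_rV n (@box n r) < +oo)%E.
Proof.
pose C : set 'rV[R]_n :=
  [set v | forall i : 'I_n, (fun=> `[- r, r]%classic) i (v ord0 i)].
have mC : measurable C.
  rewrite -[X in measurable X]setCK; apply: measurableC; apply: open_measurable_rV.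
  apply: closed_openC; apply: compact_closed; first exact: norm_hausdorff.
  by apply: rV_compact => _; exact: segment_compact.
(* An inclusion suffices, and equality can fail: for [n = 0] and [r < 0] the ball is empty while [C]
   is everything. *)
apply: (@le_lt_trans _ _ (lebesgue_rV n C)).
  apply: le_measure; rewrite ?inE//; first exact: measurable_box.
  move=> v /= vr i /=; rewrite in_itv/= -ler_norml.
  exact: (le_trans (coord_norm_le _ _)).
rewrite (@lebesgue_rV_prod R n (fun=> `[- r, r]%classic))//.
suff : (\prod_(i < n) lebesgue_measure `[(- r)%R, r]%classic)%E \is a fin_num.
  by rewrite fin_numElt => /andP[].
elim/big_ind : _ => // [x y|i _]; first exact: fin_numM.
by rewrite lebesgue_measure_itv/=; case: ifP.
Qed.

Lemma measurable_coord n (i : 'I_n) :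
  measurable_fun setT (fun v : 'rV[R]_n => v ord0 i).
Proof.
have := measurableT_comp (@measurable_tnth _ _ _ i) (@measurable_tuple_of_row R n).
by apply: eq_measurable_fun => v _ /=; rewrite tnth_mktuple.
Qed.

Lemma measurable_fun_rV d (T : measurableType d) n (f : T -> 'rV[R]_n) :
  (forall i, measurable_fun setT (fun t => f t ord0 i)) -> measurable_fun setT f.
Proof.
move=> mf.
have mg : measurable_fun setT (fun t => [tuple f t ord0 i | i < n]).
  by apply/measurable_fun_tnthP => i;
    apply: eq_measurable_fun (mf i) => t _ /=; rewrite tnth_mktuple.
have := measurableT_comp (@measurable_row_of_tuple R n) mg.
by apply: eq_measurable_fun => t _ /=; apply/rowP => i; rewrite mxE tnth_mktuple.
Qed.

Lemma measurable_funD_rV d (T : measurableType d) n (f g : T -> 'rV[R]_n) :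
  measurable_fun setT f -> measurable_fun setT g ->
  measurable_fun setT (fun t => f t + g t).
Proof.
move=> mf mg; apply: measurable_fun_rV => i.
have mc := @measurable_coord n i.
have := measurable_funD (measurableT_comp mc mf) (measurableT_comp mc mg).
by apply: eq_measurable_fun => t _ /=; rewrite mxE.
Qed.

Lemma measurable_funB_rV d (T : measurableType d) n (f g : T -> 'rV[R]_n) :
  measurable_fun setT f -> measurable_fun setT g ->
  measurable_fun setT (fun t => f t - g t).
Proof.
move=> mf mg; apply: measurable_fun_rV => i.
have mc := @measurable_coord n i.
have := measurable_funB (measurableT_comp mc mf) (measurableT_comp mc mg).
by apply: eq_measurable_fun => t _ /=; rewrite !mxE.
Qed.

Lemma continuous_measurable_rV n (f : 'rV[R]_n -> R) :
  continuous f -> measurable_fun setT f.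
Proof.
move=> cf; apply: (measurability _ (RGenOpens.measurableE R)) => _ [_ [a [b ->] <-]].
rewrite setTI; apply: open_measurable_rV; apply: open_comp => [v _|]; first exact: cf.
exact: interval_open.
Qed.

Lemma measurable_set1_rV n (x : 'rV[R]_n) : measurable [set x].
Proof.
rewrite -[X in measurable X]setCK; apply: measurableC; apply: open_measurable_rV.
by apply: closed_openC; apply: compact_closed;
  [exact: norm_hausdorff|exact: compact_set1].
Qed.

(** In positive dimension one factor of the product already vanishes, whereas in dimension 0 the
    measure is a unit mass. The hypothesis [0 < d] enters here. *)
Lemma lebesgue_rV_set1 n (x : 'rV[R]_n) : (0 < n)%N -> lebesgue_rV n [set x] = 0%E.
Proof.
case: n x => // n x _.
rewrite (_ : [set x] = [set v | forall i, (fun i => [set x ord0 i]) i (v ord0 i)]).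
  rewrite (@lebesgue_rV_prod R n.+1 (fun i => [set x ord0 i]))//.
  by rewrite big_ord_recl lebesgue_measure_set1 mul0e.
by apply/seteqP; split=> [v -> i //|v vx]; apply/rowP.
Qed.

Lemma lebesgue_rV_countable n (A : set 'rV[R]_n) : (0 < n)%N ->
  countable A -> lebesgue_rV n A = 0%E.
Proof.
move=> n0 cA; have mA := countable_measurable (@measurable_set1_rV n) cA.
apply: measure_negligible => //.
have /countable_injP[f injf] := cA.
rewrite (_ : A = \bigcup_k (A `&` f @^-1` [set k])); last first.
  by apply/seteqP; split=> [x Ax|x [k _ []]//]; exists (f x).
apply: negligible_bigcup => k.
have [->|/set0P[x [Ax fx]]] := eqVneq (A `&` f @^-1` [set k]) set0.
  exact: negligible_set0.
exists [set x]; split; [exact: measurable_set1_rV|exact: lebesgue_rV_set1|].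
by move=> y [Ay fy]; apply: injf; rewrite ?inE// fx.
Qed.

End row_vectors.

(** * Measurability of sums over the points of a configuration *)

(** The cone from which [bump_test_function] is built. *)
Lemma continuous_cone (R : realType) d (x0 : 'rV[R]_d) (c : R) :
  continuous (fun x : 'rV[R]_d => 1 - c * `|x0 - x|).
Proof.
move=> x; apply: (@cvgB R R^o 'rV[R]_d (nbhs x) _ (fun=> 1) (fun y => c * `|x0 - y|)).
  exact: cvg_cst.
apply: (@cvgM R 'rV[R]_d (nbhs x) _ (fun=> c) (fun y => `|x0 - y|)); first exact: cvg_cst.
apply: cvg_norm.
apply: (@cvgB R 'rV[R]_d 'rV[R]_d (nbhs x) _ (fun=> x0) id x0 x); first exact: cvg_cst.
exact: cvg_id.
Qed.

Section counting.
Context {R : realType} {d : nat}.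
Local Notation X := 'rV[R]_d.
Implicit Types g : config R d.
Local Open Scope ereal_scope.

Lemma finite_config_box g r : finite_set (config_set g `&` @box R d r).
Proof. by apply: config_locally_finite; exact: compact_box. Qed.

Lemma countable_config g : countable (config_set g).
Proof.
rewrite (_ : config_set g = \bigcup_(n : nat) (config_set g `&` @box R d n%:R)).
  by apply: bigcup_countable => // n _; exact/finite_set_countable/finite_config_box.
apply/seteqP; split=> [x gx|x [n _ []]//].
exists (Num.truncn `|x|%R).+1 => //; split => //=; rewrite /box/=.
by apply/ltW; rewrite truncnS_gt.
Qed.

Lemma measurable_config g : measurable (config_set g).
Proof.
by apply: countable_measurable; [exact: measurable_set1_rV|exact: countable_config].
Qed.

Lemma lebesgue_config g : (0 < d)%N -> lebesgue_rV d (config_set g) = 0.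
Proof. by move=> d0; apply: lebesgue_rV_countable => //; exact: countable_config. Qed.

(** An injection [u] into the natural numbers indexes the points, [e] inverts it, and the measure is
    the series of unit masses at [e n] over the indices in use. A genuine measure, rather than a
    bare [\esum], gives access to Dynkin's theorem and to kernels. *)
Lemma ex_config_measure g : exists m : {measure set X -> \bar R},
  forall f : X -> \bar R, measurable_fun setT f -> (forall x, 0 <= f x) ->
    \int[m]_x f x = \esum_(x in g) f x.
Proof.
have /countable_injP[u uI] := countable_config g.
pose e n := xget (0%R : X) [set x | config_set g x /\ u x = n].
have eu x : config_set g x -> e (u x) = x.
  move=> gx; rewrite /e; case: xgetP => [y -> [gy uy]|/(_ x)]; last by case.
  by apply: uI; rewrite ?inE.
pose m_ n : {measure set X -> \bar R} :=
  if n \in u @` config_set g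
  then (dirac (e n) : {measure set X -> \bar R}) else (mzero : {measure set X -> \bar R}).
exists (mseries m_ 0) => f mf f0.
rewrite ge0_integral_measure_series//.
have a0 n : 0 <= \int[m_ n]_x f x by exact: integral_ge0.
rewrite nneseries_esumT//.
transitivity (\esum_(n in u @` config_set g) \int[m_ n]_x f x).
  rewrite [RHS]esum_mkcond; apply: eq_esum => n _.
  by rewrite /m_; case: ifPn => // _; rewrite integral_measure_zero.
rewrite esum_image; last exact: uI.
apply: eq_esum => x gx; rewrite /m_ mem_set; last by exists x.
by rewrite integral_dirac// eu// diracT mul1e.
Qed.

Definition config_measure g := sval (cid (ex_config_measure g)).

Lemma integral_config_measure g (f : X -> \bar R) :
  measurable_fun setT f -> (forall x, 0 <= f x) ->
  \int[config_measure g]_x f x = \esum_(x in g) f x.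
Proof. by rewrite /config_measure; case: cid => m /= + mf f0; apply. Qed.

Lemma config_measureE g A : measurable A ->
  config_measure g A = \esum_(x in config_set g `&` A) 1.
Proof.
move=> mA; rewrite -(setIT A) -integral_indic// integral_config_measure//.
- by rewrite esum_mkcondr setIT; apply: eq_esum => x _; rewrite indicE; case: (x \in A).
- by apply/measurable_EFinP; exact: measurable_indic.
Qed.

Lemma test_function_bounded_support (f : X -> R) r : continuous f ->
  (forall x, (r < `|x|)%R -> f x = 0%R) -> test_function f.
Proof.
move=> cf f0; split=> //; apply: (subclosed_compact (@closed_closure _ _) (@compact_box R d r)).
rewrite closureE; apply: smallest_sub.
  by apply: compact_closed; [exact: norm_hausdorff|exact: compact_box].
by move=> x /=; apply: contraNle => /f0 ->.
Qed.

Lemma test_function_support (f : X -> R) : test_function f ->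
  exists r : R, forall x, (r < `|x|)%R -> f x = 0%R.
Proof.
move=> [_ /compact_bounded [M [Mr HM]]]; exists (M + 1)%R => x Mx.
apply/eqP/negPn/negP => fx0.
have := HM (M + 1)%R; rewrite ltrDl => /(_ ltr01 x) /=.
have fx : closure [set x | f x != 0%R] x by exact: subset_closure.
by move=> /(_ fx); rewrite leNgt Mx.
Qed.

(** Induction on [S]: each point contributes a cone of height 1 whose radius is that of a ball
    inside [U]. Cones are combined by a maximum, which keeps the values at most 1 and the support
    bounded. *)
Lemma bump_test_function (U S : set X) : open U -> finite_set S -> S `<=` U ->
  exists f : X -> R, [/\ test_function f, forall x, (0 <= f x)%R,
    forall x, (f x <= \1_U x)%R & forall x, S x -> f x = 1%R].
Proof.
move=> oU /finite_seqP[s ->{S}]; elim: s => [|x0 s ih] sU.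
  exists (fun=> 0%R); split=> //.
  by apply: (@test_function_bounded_support _ 0%R) => //; exact: cst_continuous.
have [|f [tf f0 fU f1]] := ih.
  by move=> x /= xs; apply: sU => /=; rewrite inE xs orbT.
have Ux0 : U x0 by apply: sU => /=; rewrite inE eqxx.
have /nbhs_ballP[e /= e0 eU] : nbhs x0 U by exact: open_nbhs_nbhs.
pose b x : R := Num.max 0%R (1 - e^-1 * `|x0 - x|)%R.
have b0 x : (e <= `|x0 - x|)%R -> b x = 0%R.
  move=> ex; apply/max_idPl; rewrite subr_le0 mulrC ler_pdivlMr// mul1r//.
have cb : continuous b.
  move=> x; apply: (@continuous_max _ _ ((fun=> 0%R) : X -> R^o)
      (fun x => 1 - e^-1 * `|x0 - x|)%R x); first exact: cst_continuous.
  exact: continuous_cone.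
exists (fun x => Num.max (f x) (b x)); split.
- have [r fr] := test_function_support tf.
  apply: (@test_function_bounded_support _ (Num.max r (`|x0| + e))%R).
    by move=> x; apply: (@continuous_max _ _ (f : X -> R^o) b x);
      [case: tf => + _; apply|exact: cb].
  move=> x; rewrite gt_max => /andP[rx ex]; rewrite fr// b0 ?maxxx//.
  rewrite distrC; apply: le_trans (lerB_dist _ _).
  by rewrite lerBrDl ltW.
- by move=> x; rewrite le_max f0.
- move=> x; rewrite ge_max fU/= indicE; have [xU|xU] := boolP (x \in U).
    rewrite /b ge_max ler01/= lerBlDr lerDl mulr_ge0// invr_ge0 ltW//.
  rewrite b0// leNgt; apply: contra xU => xe.
  by rewrite inE; apply: eU; rewrite mx_norm_ball.
- move=> x /=; rewrite inE => /orP[/eqP ->|xs].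
    rewrite /b subrr normr0 mulr0 subr0 (max_idPr ler01); apply/max_idPr.
    by rewrite (le_trans (fU _))// indicE; case: (_ \in _).
  rewrite f1//; apply/max_idPl; rewrite ge_max ler01/= lerBlDr lerDl mulr_ge0//.
  by rewrite invr_ge0 ltW.
Qed.

Lemma open_pairing (f : X -> R) (U : set R) : test_function f -> open U ->
  open [set g : config R d | U (pairing f g)].
Proof.
move=> tf oU.
exists [set [set g : config R d | U (pairing f g)]]; last by rewrite bigcup_set1.
move=> _ ->; exact: (@finI_from1 _ _ [set fU : (X -> R) * set R | test_function fU.1 /\ open fU.2]
  (fun fU => pairing fU.1 @^-1` fU.2) (f, U)).
Qed.

Lemma measurable_pairing (f : X -> R) : test_function f ->
  measurable_fun setT (pairing f : config R d -> R).
Proof.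
move=> tf; apply: (measurability _ (RGenOpens.measurableE R)) => _ [_ [a [b ->] <-]].
rewrite setTI; apply: sub_sigma_algebra; exact: open_pairing.
Qed.

Lemma pairing_esum (f : X -> R) g : test_function f -> (forall x, 0 <= f x)%R ->
  (pairing f g)%:E = \esum_(x in g) (f x)%:E.
Proof.
move=> tf f0; have [r fr] := test_function_support tf.
rewrite (esumID (@box R d r)); last by move=> x _; rewrite lee_fin.
rewrite [X in _ + X]esum1 ?adde0; last first.
  by move=> x [_ /= /negP]; rewrite -ltNge => /fr ->.
rewrite esum_fset; [|exact: finite_config_box|by move=> x _; rewrite lee_fin].
rewrite fsumEFin; last exact: finite_config_box.
congr (_%:E); rewrite /pairing; apply/esym/fsbig_widen; first exact: subIsetl.
move=> x [/= gx xr]; apply: fr; rewrite ltNge; apply/negP => xr'; exact: xr.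
Qed.

(* Lower semicontinuity of [g |-> #(g `&` U)] in the vague topology: it is the
   supremum of the [pairing f] over the test functions [0 <= f <= \1_U]. *)
Lemma measurable_esum_open (U : set X) : open U ->
  measurable_fun setT (fun g : config R d => \esum_(x in g) (\1_U x : R)%:E).
Proof.
move=> oU; apply: (measurability _ (ErealGenOInfty.measurableE R)) => _ [_ [r ->] <-].
rewrite setTI; apply: sub_sigma_algebra.
rewrite (_ : _ @^-1` _ =
  \bigcup_(f in [set f : X -> R | [/\ test_function f,
     forall x, (0 <= f x)%R & forall x, (f x <= \1_U x)%R]])
  [set g : config R d | (`]r, +oo[%classic : set R) (pairing f g)]).
  apply: bigcup_open => f [tf _ _]; exact: open_pairing.
apply/seteqP; split => [g /=|g [f [/= tf f0 fU]]]; last first.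
  rewrite !in_itv/= !andbT => rf; apply: (@lt_le_trans _ _ (pairing f g)%:E).
    by rewrite lte_fin.
  by rewrite pairing_esum//; apply: le_esum => x _; rewrite lee_fin.
(* A count above [r] exceeds [r] already on a finite subset [S] of [g], and a bump equal to 1 on the
   points of [S] in [U] preserves the excess. *)
rewrite in_itv/= andbT => /ereal_sup_gt[_ [S [finS Sg] <-] rS].
have [|f [tf f0 fU f1]] := bump_test_function oU (finite_setIl U finS).
  by move=> x [].
exists f; first by split.
suff : r%:E < (pairing f g)%:E by rewrite /= in_itv/= andbT lte_fin.
rewrite pairing_esum//.
apply: (lt_le_trans rS); apply: esum_ge; exists S => //.
apply: lee_fsum => // x Sx; rewrite lee_fin indicE.
have [|_] := boolP (x \in U); last exact: f0.
by rewrite inE => Ux; rewrite f1.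
Qed.

End counting.

(** * The counting measure as a measurable kernel *)

Section measurability_counting.
Context {R : realType} {d : nat}.
Local Notation X := 'rV[R]_d.
Implicit Types g : config R d.
Local Open Scope ereal_scope.

Definition open_box (n : nat) : set X := [set v | (`|v| < n%:R)%R].

Lemma open_open_box n : open (open_box n).
Proof.
rewrite (_ : open_box n = (fun v => `|v|%R) @^-1` [set x | (x < n%:R)%R])//.
apply: open_comp; last exact: open_lt.
by move=> v _; exact: norm_continuous.
Qed.

Lemma measurable_open_box n : measurable (open_box n).
Proof. by apply: open_measurable_rV; exact: open_open_box. Qed.

Lemma finite_open_box g n : finite_set (config_set g `&` open_box n).
Proof.
apply: (sub_finite_set _ (finite_config_box g n%:R)) => x [gx xn]; split=> //.
exact: ltW.
Qed.

Lemma config_measure_open_box g n A : measurable A ->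
  config_measure g (A `&` open_box n) \is a fin_num.
Proof.
move=> mA; rewrite config_measureE; last by apply: measurableI => //; exact: measurable_open_box.
have fA : finite_set (config_set g `&` (A `&` open_box n)).
  by apply: (sub_finite_set _ (finite_open_box g n)) => x [? []].
by rewrite esum_fset// (fsumEFin (fun=> 1%R) fA).
Qed.

Lemma open_box_cvg (m : {measure set X -> \bar R}) A : measurable A ->
  m (A `&` open_box n) @[n --> \oo] --> m A.
Proof.
move=> mA; have mI n : measurable (A `&` open_box n).
  by apply: measurableI => //; exact: measurable_open_box.
have -> : A = \bigcup_n (A `&` open_box n).
  rewrite -setI_bigcupr; apply/esym/setIidPl => x _.
  exists (Num.truncn `|x|%R).+1 => //; rewrite /open_box/=.
  by rewrite truncnS_gt.
rewrite [X in X @ _ --> _](_ : _ = m \o (fun n => A `&` open_box n)); last first.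
  apply/funext => n /=; congr (m _); apply/seteqP; split=> [x [[k _ []]]|x []]//.
  by move=> Ax nx; split=> //; exists n.
apply: nondecreasing_cvg_mu => //; first exact: bigcupT_measurable.
move=> n k nk; apply/subsetPset => x [Ax]; rewrite /open_box/= => xn; split=> //=.
by rewrite (lt_le_trans xn)// ler_nat.
Qed.

(** Dynkin's theorem, generated by the open sets. Counts are cut to [open_box n] because passing to
    a complement subtracts them, which requires finite values; then [n] tends to infinity. *)
Lemma measurable_config_measure A : measurable A ->
  measurable_fun setT (fun g => config_measure g A).
Proof.
have hO (U : set X) : open U -> measurable_fun setT (fun g => config_measure g U).
  move=> oU; apply: eq_measurable_fun (measurable_esum_open oU) => g _.
  rewrite config_measureE; last exact: open_measurable_rV.
  by rewrite esum_mkcondr; apply: eq_esum => x _; rewrite indicE; case: (x \in U).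
suff h n : measurable A -> measurable_fun setT (fun g => config_measure g (A `&` open_box n)).
  move=> mA; apply: (emeasurable_fun_cvg (fun n g => config_measure g (A `&` open_box n))).
    by move=> n; exact: h.
  by move=> g _; exact: open_box_cvg.
move: A; apply: (@dynkin_induction _ X open
  (fun A => measurable_fun setT (fun g : config R d => config_measure g (A `&` open_box n)))) => //.
- exact: openI.
- by rewrite setTI; apply: hO; exact: open_open_box.
- by move=> U oU; apply: hO; apply: openI => //; exact: open_open_box.
- move=> S mS mf; apply: (eq_measurable_fun (fun g =>
    config_measure g (setT `&` open_box n) - config_measure g (S `&` open_box n))).
    move=> g _; rewrite setTI [in RHS]setIC -setDE measureD//.
    - by rewrite [in LHS]setIC.
    - exact: measurable_open_box.
    - rewrite -(setTI (open_box n)) ltey_eq.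
      by apply/orP; left; exact: config_measure_open_box.
  apply: emeasurable_funB => //.
  by rewrite setTI; apply: hO; exact: open_open_box.
- move=> F mF tF mf; apply: (eq_measurable_fun (fun g =>
    \sum_(0 <= k <oo) config_measure g (F k `&` open_box n))).
    move=> g _; rewrite setI_bigcupl measure_semi_bigcup//.
    + by move=> k; apply: measurableI => //; exact: measurable_open_box.
    + exact: trivIset_setIr.
    + by apply: bigcupT_measurable => k; apply: measurableI => //; exact: measurable_open_box.
  by apply: ge0_emeasurable_sum => // k _ ; exact: mf.
Qed.

Section kernel.
Context dT (T : measurableType dT).

(** The component in [T] is a silent parameter: sections and integrands depend on it, the measure
    does not. *)
Definition config_kernel (p : config R d * T) := config_measure p.1.

Let measurable_config_kernel U : measurable U ->
  measurable_fun setT (config_kernel ^~ U).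
Proof.
move=> mU; apply: (measurableT_comp (measurable_config_measure mU)).
exact: measurable_fst.
Qed.

HB.instance Definition _ := isKernel.Build _ _ _ _ _ config_kernel measurable_config_kernel.

(** A configuration may be infinite, so the finiteness that the kernel lemma asks for is obtained by
    cutting to [open_box n]; the cut is removed by continuity from below. *)
Lemma measurable_config_xsection (D : set ((config R d * T) * X)) : measurable D ->
  measurable_fun setT (fun p => config_measure p.1 (xsection D p)).
Proof.
move=> mD.
apply: (emeasurable_fun_cvg (fun n p => config_measure p.1 (xsection D p `&` open_box n))).
  move=> n; have := @measurable_prod_subset_xsection_kernel _ _ _ _ _ config_kernel
    _ (measurable_open_box n).
  move=> /(_ _ _ mD) []//.
  move=> p; exists (fine (config_measure p.1 (setT `&` open_box n)) + 1)%R => B mB.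
  rewrite EFinD fineK; last exact: config_measure_open_box.
  change (config_measure p.1 (B `&` open_box n) <
    config_measure p.1 (setT `&` open_box n) + 1%:E).
  have mO := measurable_open_box n.
  apply: (@le_lt_trans _ _ (config_measure p.1 (setT `&` open_box n))).
    apply: le_measure; last exact: setSI.
    - by rewrite inE; exact: measurableI.
    - by rewrite inE; exact: measurableI.
  by rewrite lteDl ?lte01//; exact: config_measure_open_box.
by move=> p _; apply: open_box_cvg; exact: measurable_xsection.
Qed.

Import HBNNSimple.

(** Since [K] may depend on the configuration itself, it is approximated by simple functions of [p]
    and [x] together; the sections of their level sets are covered by
    [measurable_config_xsection]. *)
Lemma measurable_esum_config (K : (config R d * T) * X -> \bar R) :
  measurable_fun setT K -> (forall p, 0 <= K p) ->
  measurable_fun setT (fun p : config R d * T => \esum_(x in p.1) K (p, x)).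
Proof.
move=> mK K0.
apply: (eq_measurable_fun (fun p => \int[config_measure p.1]_x K (p, x))).
  move=> p _; apply: integral_config_measure => //.
  exact: measurableT_comp mK (measurable_pair1 p).
apply: (measurable_fun_xsection_integral K (fun p => config_measure p.1)
  (nnsfun_approx measurableT mK)).
- by move=> a b ab; exact/nd_nnsfun_approx.
- by move=> z; exact/cvg_nnsfun_approx.
- by move=> n r; apply: measurable_config_xsection; exact: measurable_funPTI.
Qed.

End kernel.
End measurability_counting.

(** * Signed sums with finite support *)

Section signed_sums.
Context {R : realType}.

Lemma esum_fsum (T : choiceType) (D : set T) (f : T -> R) :
  finite_set (D `&` [set x | f x != 0]) -> (forall x, 0 <= f x) ->
  (\esum_(x in D) (f x)%:E = (\sum_(x \in D) f x)%:E)%E.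
Proof.
move=> fin f0; rewrite (esumID [set x | f x != 0]); last by move=> x _; rewrite lee_fin.
rewrite [X in (_ + X)%E]esum1 ?adde0; last first.
  by move=> x [_ /= /negP]; rewrite negbK => /eqP ->.
rewrite esum_fset//; last by move=> x _; rewrite lee_fin.
rewrite fsumEFin//; congr EFin; apply: fsbig_widen; first exact: subIsetl.
by move=> x [/= Dx nx]; apply: contrapT => fx; apply: nx; split=> //; exact/eqP.
Qed.

(** Both parts of [f] live on its finite support, so neither sum is infinite and the subtraction in
    [ssum] is one of real numbers. *)
Lemma ssum_fsum (T : choiceType) (D : set T) (f : T -> R) :
  finite_set (D `&` [set x | f x != 0]) ->
  ssum D (fun x => (f x)%:E) = (\sum_(x \in D) f x)%:E.
Proof.
move=> fin; have sub (g : T -> R) : (forall x, f x = 0 -> g x = 0) ->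
    (D `&` [set x | g x != 0]) `<=` (D `&` [set x | f x != 0]).
  by move=> h x [Dx /= gx]; split=> //=; apply: contra gx => /eqP /h ->.
have fp : finite_set (D `&` [set x | Num.max (f x) 0 != 0]).
  by apply: sub_finite_set fin; apply: sub => x ->; rewrite maxxx.
have fm : finite_set (D `&` [set x | Num.max (- f x) 0 != 0]).
  by apply: sub_finite_set fin; apply: sub => x ->; rewrite oppr0 maxxx.
rewrite /ssum (eq_esum (b := fun x => (Num.max (f x) 0)%:E)); last first.
  by move=> x _; rewrite funeposE EFin_max.
rewrite [X in (_ - X)%E](eq_esum (b := fun x => (Num.max (- f x) 0)%:E)); last first.
  by move=> x _; rewrite funenegE EFin_max.
rewrite !esum_fsum => [|//|x|//|x]; rewrite ?le_max ?lexx ?orbT//.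
rewrite -EFinB; congr EFin.
have wd (g : T -> R) : (forall x, f x = 0 -> g x = 0) ->
    \sum_(x \in D) g x = \sum_(x <- fset_set (D `&` [set x | f x != 0])) g x.
  move=> h; rewrite -fsbig_finite//; apply/esym/fsbig_widen; first exact: subIsetl.
  move=> x [/= Dx nx]; apply: h; apply: contrapT => fx; apply: nx; split=> //.
  exact/eqP.
rewrite !wd; [|by []|by move=> x ->; rewrite oppr0 maxxx|by move=> x ->; rewrite maxxx].
rewrite -sumrB; apply: eq_bigr => x _.
have [f0|f0] := leP (f x) 0; first by rewrite max_l ?oppr_ge0// sub0r opprK.
by rewrite max_r ?oppr_le0 ?ltW// subr0.
Qed.

End signed_sums.

(** * Sums over a configuration and the effect of adding a point *)

Section config_sums.
Context {R : realType} {d : nat}.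
Local Notation X := 'rV[R]_d.
Implicit Types g : config R d.

Lemma config_eq g g' : config_set g = config_set g' -> g = g'.
Proof.
case: g g' => [A hA] [B hB] /= AB; case: B / AB hB => hB.
by congr Config; exact: Prop_irrelevance.
Qed.

Lemma config_del_add x g : config_set g x -> config_add x (config_del g [set x]) = g.
Proof.
move=> gx; apply: config_eq; apply/seteqP; split=> [y [->|[]]//|y gy].
by have [->|/eqP yx] := eqVneq y x; [left|right].
Qed.

Lemma finite_config_support g r (f : X -> R) :
  (forall x, r < `|x| -> f x = 0) -> finite_set (config_set g `&` [set x | f x != 0]).
Proof.
move=> f0; apply: (sub_finite_set _ (finite_config_box g r)) => x [gx /= fx].
by split=> //; rewrite /box/= leNgt; apply: contra fx => /f0 ->.
Qed.

(** One list serves all functions supported in the box, so different sums over [g] can be combined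
    by the laws of finite sums. *)
Lemma config_sum_seq g r : exists s : seq X, [/\ uniq s,
  forall x, x \in s <-> config_set g x /\ `|x| <= r &
  forall f : X -> R, (forall x, r < `|x| -> f x = 0) ->
    \sum_(x \in config_set g) f x = \sum_(x <- s) f x].
Proof.
have fin := finite_config_box g r.
exists (fset_set (config_set g `&` @box R d r)); split => [||f f0].
- exact: fset_uniq.
- by move=> x; rewrite in_fset_set//; split=> [/set_mem|?]; last exact: mem_set.
- rewrite -[RHS](fsbig_finite _ _ fin); apply/esym/fsbig_widen; first exact: subIsetl.
  move=> x [/= gx xr]; apply: f0; rewrite ltNge; apply/negP => xr'; exact: xr.
Qed.

Lemma config_sum_add g x r (f : X -> R) : ~ config_set g x ->
  (forall x, r < `|x| -> f x = 0) ->
  \sum_(y \in config_set (config_add x g)) f y = f x + \sum_(y \in config_set g) f y.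
Proof.
(* The radius is enlarged so that the box contains [x], which may lie outside the box of radius
   [r]. *)
move=> gx f0; have [s [us sP ss]] := config_sum_seq g (Num.max r `|x|).
have f0' y : Num.max r `|x| < `|y| -> f y = 0 by rewrite gt_max => /andP[/f0].
rewrite ss//; have [s' [us' s'P ->//]] := config_sum_seq (config_add x g) (Num.max r `|x|).
rewrite (perm_big (x :: s)) ?big_cons//; apply: uniq_perm => //=.
  by rewrite us andbT; apply/negP => /sP[].
move=> y; rewrite inE; apply/idP/idP.
  move=> /s'P[[->|gy] yr]; first by rewrite eqxx.
  by apply/orP; right; exact/sP.
move=> /orP[/eqP ->|/sP[gy yr]]; apply/s'P; split=> //; [by left| |by right].
by rewrite le_max lexx orbT.
Qed.

Lemma config_esum_add g x (f : X -> \bar R) : ~ config_set g x ->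
  (forall x, 0 <= f x)%E ->
  (\esum_(y in config_add x g) f y = f x + \esum_(y in g) f y)%E.
Proof.
move=> gx f0; rewrite (esumID [set x])//; congr (_ + _)%E.
  rewrite (_ : _ `&` _ = [set x]); first exact: esum_set1.
  by apply/seteqP; split=> [y []//|y ->]; split=> //; left.
congr (esum _ _); apply/seteqP; split=> [y [[]//]|y gy].
by split; [right|move=> /= yx; apply: gx; rewrite -yx].
Qed.

End config_sums.

(** * Parameters, and changes on a countable set *)

Section measurability.
Context {R : realType} {d : nat} dT (T : measurableType dT).
Local Notation X := 'rV[R]_d.

Lemma measurable_config_sum (K : (config R d * T) * X -> R) r :
  measurable_fun setT K -> (forall p x, r < `|x| -> K (p, x) = 0) ->
  measurable_fun setT (fun p : config R d * T => \sum_(x \in config_set p.1) K (p, x)).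
Proof.
move=> mK K0; apply/measurable_EFinP.
have mKE : measurable_fun setT (EFin \o K) by exact/measurable_EFinP.
apply: (eq_measurable_fun (fun p : config R d * T =>
    \esum_(x in p.1) (EFin \o K)^\+ (p, x) - \esum_(x in p.1) (EFin \o K)^\- (p, x)))%E.
  move=> p _; rewrite /= -ssum_fsum.
    by rewrite /ssum; congr (_ - _)%E; apply: eq_esum => x _; rewrite ?funeposE ?funenegE.
  by apply: (@finite_config_support R d p.1 r (fun x => K (p, x))) => x; exact: K0.
apply: emeasurable_funB.
  by apply: measurable_esum_config => //; exact: measurable_funepos.
by apply: measurable_esum_config => //; exact: measurable_funeneg.
Qed.

(** Tonelli handles the positive and negative parts without any integrability, and [fine] of their
    difference is measurable whatever its value. *)
Lemma measurable_integral_param (K : T * X -> R) : measurable_fun setT K ->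
  measurable_fun setT (fun t => \int[lebesgue_rV d]_x (K (t, x)))%R.
Proof.
move=> mK; have mKE : measurable_fun setT (EFin \o K) by exact/measurable_EFinP.
apply: measurableT_comp; first exact: fine_measurable.
apply: (eq_measurable_fun (fun t => \int[lebesgue_rV d]_x (EFin \o K)^\+ (t, x) -
  \int[lebesgue_rV d]_x (EFin \o K)^\- (t, x)))%E.
  move=> t _; rewrite [RHS]integralE; congr (_ - _)%E;
    by apply: eq_integral => x _; rewrite ?funeposE ?funenegE.
apply: emeasurable_funB.
  by apply: measurable_fun_fubini_tonelli_F => //; exact: measurable_funepos.
by apply: measurable_fun_fubini_tonelli_F => //; exact: measurable_funeneg.
Qed.

(** Points are Borel, hence so is every subset of the countable set [N], and the values on [N]
    cannot spoil measurability. It is applied with [N] a configuration, where formulas for an added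
    point may fail. *)
Lemma measurable_fun_off_countable (f f' : X -> \bar R) (N : set X) : countable N ->
  measurable_fun setT f' -> (forall x, ~ N x -> f x = f' x) -> measurable_fun setT f.
Proof.
move=> cN mf' ff' _ B mB; rewrite setTI.
have mC (A : set X) : A `<=` N -> measurable A.
  move=> AN; apply: countable_measurable; first exact: measurable_set1_rV.
  by apply: sub_countable cN; exact: subset_card_le.
rewrite (_ : f @^-1` B = (N `&` f @^-1` B) `|` (f' @^-1` B `\` N)).
  apply: measurableU; first by apply: mC; exact: subIsetl.
  apply: measurableD; last exact: mC.
  by rewrite -[X in measurable X]setTI; exact: mf'.
apply/seteqP; split=> [x /= fx|x [[]//|[/= fx Nx]]]; last by rewrite /= ff'.
by have [Nx|Nx] := pselect (N x); [left|right; split=> //=; rewrite -ff'].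
Qed.

Lemma integral_off_config (g : config R d) (f f' : X -> \bar R) : (0 < d)%N ->
  measurable_fun setT f' -> (forall x, ~ config_set g x -> f x = f' x) ->
  (\int[lebesgue_rV d]_x f x = \int[lebesgue_rV d]_x f' x)%E.
Proof.
move=> d0 mf' ff'; apply: ae_eq_integral => //.
  exact: measurable_fun_off_countable (countable_config g) mf' ff'.
exists (config_set g); split; [exact: measurable_config|exact: lebesgue_config|].
by move=> x /= /not_implyP[_]; apply: contra_notP => /ff'.
Qed.

End measurability.

Lemma measurable_config_sum_cst {R : realType} {d : nat} (K : config R d * 'rV[R]_d -> R) r :
  measurable_fun setT K -> (forall g x, r < `|x| -> K (g, x) = 0) ->
  measurable_fun setT (fun g : config R d => \sum_(x \in config_set g) K (g, x)).
Proof.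
move=> mK K0.
have mp : measurable_fun setT (fun q : (config R d * nat) * 'rV[R]_d => (q.1.1, q.2)).
  apply: measurable_fun_pair; last exact: measurable_snd.
  by apply: (measurableT_comp measurable_fst); exact: measurable_fst.
(* [nat] is a dummy parameter space, evaluated at 0. *)
have := @measurable_config_sum R d _ nat _ r (measurableT_comp mK mp) (fun p x => K0 p.1 x).
by move=> /measurableT_comp/(_ (pair2_measurable 0%N)).
Qed.

(** * The Papangelou intensity *)

Section energy.
Context {R : realType} {d : nat}.
Local Notation X := 'rV[R]_d.
Context (phi : X -> \bar R) (z : R).
Hypothesis phi_meas : measurable_fun setT phi.
Hypothesis phi_ge0 : forall x, (0 <= phi x)%E.
Hypothesis z_ge0 : 0 <= z.
Implicit Types g : config R d.

(** For nonnegative [phi] the two branches of [energy] agree: a sum that does not converge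
    absolutely is itself [+oo]. *)
Lemma energyE x g : energy phi x g = (\esum_(y in g) phi (x - y)%R)%E.
Proof.
have phiE : ssum g (fun y => phi (x - y)) = (\esum_(y in g) phi (x - y)%R)%E.
  rewrite /ssum [X in (_ - X)%E]esum1 ?sube0; last first.
    by move=> y _; rewrite funenegE; apply/max_idPr; rewrite leeNl oppe0.
  by apply: eq_esum => y _; rewrite funeposE; apply/max_idPl.
rewrite /energy; case: asboolP => // /negP; rewrite /summable -leNgt leye_eq => /eqP <-.
by apply: eq_esum => y _; rewrite gee0_abs.
Qed.

Lemma energy_ge0 x g : (0 <= energy phi x g)%E.
Proof. by rewrite energyE esum_ge0. Qed.

Lemma energy_add x y g : ~ config_set g y ->
  energy phi x (config_add y g) = (phi (x - y)%R + energy phi x g)%E.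
Proof. by move=> gy; rewrite !energyE config_esum_add. Qed.

Lemma energy_ge x y g : config_set g y -> (phi (x - y)%R <= energy phi x g)%E.
Proof.
move=> gy; rewrite energyE; apply: esum_ge; exists [set y]; last by rewrite fsbig_set1.
by split; [exact: finite_set1|move=> _ ->].
Qed.

Definition intensity (p : config R d * X) : R :=
  z * fine (expeR (- energy phi p.2 p.1)).

Lemma intensityE p : (intensity p)%:E = (z%:E * expeR (- energy phi p.2 p.1))%E.
Proof.
rewrite /intensity EFinM fineK//; have := energy_ge0 p.2 p.1.
by case: energy => [r| |]//= _; rewrite leye_eq.
Qed.

Lemma intensity_ge0 p : 0 <= intensity p.
Proof. by rewrite mulr_ge0// fine_ge0// expeR_ge0. Qed.

Lemma intensity_le p : intensity p <= z.
Proof.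
rewrite -lee_fin intensityE -[leRHS]mule1 lee_wpmul2l ?lee_fin//.
by rewrite -expeR0 lee_expeR leeNl oppe0 energy_ge0.
Qed.

Lemma measurable_intensity : measurable_fun setT intensity.
Proof.
have mE : measurable_fun setT (fun p : config R d * X => energy phi p.2 p.1).
  pose K (q : (config R d * X) * X) : \bar R := phi (q.1.2 - q.2).
  apply: (eq_measurable_fun (fun p : config R d * X => \esum_(x in p.1) K (p, x)))%E.
    by move=> p _; rewrite energyE.
  apply: measurable_esum_config => [|q]; last exact: phi_ge0.
  apply: (measurableT_comp phi_meas); apply: measurable_funB_rV; last exact: measurable_snd.
  by apply: (measurableT_comp measurable_snd); exact: measurable_fst.
apply: measurable_funM; first exact: measurable_cst.
apply: (eq_measurable_fun (fun p : config R d * X =>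
  if energy phi p.2 p.1 \is a fin_num then expR (- fine (energy phi p.2 p.1)) else 0)).
  move=> p _; have := energy_ge0 p.2 p.1.
  by case: energy => [r| |]//= _; rewrite leye_eq.
apply: measurable_fun_ifT => //.
  by apply: (measurable_fun_bool true); have := emeasurable_fin_num measurableT mE; rewrite setTI.
apply: measurableT_comp => //; apply: measurableT_comp => //.
exact: measurableT_comp.
Qed.

Lemma intensity_add x y g : ~ config_set g y ->
  (intensity (config_add y g, x))%:E = ((intensity (g, x))%:E * expeR (- phi (x - y)%R))%E.
Proof.
move=> gy; rewrite !intensityE/= energy_add//.
by rewrite oppeD ?ge0_adde_def ?inE ?energy_ge0// expeRD muleA muleAC.
Qed.

(** Finiteness of [phi (x - y)] is essential: at the value [+oo] the left side would be 0. *)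
Lemma intensity_addK x y g : ~ config_set g y -> phi (x - y) \is a fin_num ->
  intensity (config_add y g, x) * expR (fine (phi (x - y))) = intensity (g, x).
Proof.
move=> gy fin; apply: EFin_inj; rewrite EFinM intensity_add//.
by rewrite -[phi _]fineK// -EFinN/= -!EFinM -mulrA -expRD addNr expR0 mulr1.
Qed.

(** Keeping only the term of [y] in the energy bounds the intensity by z e^{-phi(x-y)}. *)
Lemma intensity_expR_le x y g : config_set g y -> phi (x - y) \is a fin_num ->
  intensity (g, x) * expR (fine (phi (x - y))) <= z.
Proof.
move=> gy fin; rewrite -ler_pdivlMr ?expR_gt0// -expRN.
rewrite -lee_fin intensityE EFinM lee_wpmul2l ?lee_fin//=.
rewrite -[leRHS]/(expeR (- fine (phi (x - y)))%:E) lee_expeR EFinN fineK// leeN2.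
exact: energy_ge.
Qed.

End energy.

(** * The Gibbs identity for signed functions *)

Section mecke.
Context {R : realType} {d : nat}.
Local Notation X := 'rV[R]_d.
Context (phi : X -> \bar R) (z r : R) (mu : probability (config R d) R).
Hypothesis d_gt0 : (0 < d)%N.
Hypothesis phi_meas : measurable_fun setT phi.
Hypothesis phi_ge0 : forall x, (0 <= phi x)%E.
Hypothesis z_ge0 : 0 <= z.
Hypothesis mu_gibbs : gibbs z phi mu.
Implicit Types g : config R d.

Local Notation a := (intensity phi z).
Local Notation b1 := (\1_(@box R d r) : X -> R).
Local Notation la := (@lebesgue_rV R d).
Let ma := measurable_intensity z phi_meas phi_ge0.

Definition box_count g : R := \sum_(x \in config_set g) b1 x.

Let box1_0 (x : X) : r < `|x| -> b1 x = 0 :> R.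
Proof. by move=> rx; rewrite indicE memNset// /box/=; apply/negP; rewrite -ltNge. Qed.

Let box1_ge0 (x : X) : 0 <= b1 x :> R.
Proof. by rewrite indicE. Qed.

Let mbox1 : measurable_fun setT b1.
Proof. apply: measurable_indic; exact: measurable_box. Qed.

Lemma box_count_ge0 g : 0 <= box_count g.
Proof. by apply: fsumr_ge0 => x _; exact: box1_ge0. Qed.

Lemma measurable_box_count : measurable_fun setT box_count.
Proof.
apply: (@measurable_config_sum_cst R d (fun p => b1 p.2) r).
  exact: measurableT_comp mbox1 measurable_snd.
by move=> g x; exact: box1_0.
Qed.

Lemma integrable_box (f : X -> R) c : measurable_fun setT f ->
  (forall x, `|f x| <= c * b1 x) -> la.-integrable setT (EFin \o f).
Proof.
move=> mf fc; have mb := @measurable_box R d r.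
have ib : la.-integrable setT (fun x => (c * b1 x)%:E).
  apply: (@integrableZl _ _ _ la setT measurableT c (fun x => (b1 x)%:E)).
  apply/integrableP; split; first exact/measurable_EFinP.
  rewrite (eq_integral (fun x => (b1 x)%:E)); last first.
    by move=> x _; rewrite gee0_abs// lee_fin.
  by rewrite integral_indic// setIT; exact: lebesgue_box.
apply: (le_integrable measurableT _ _ ib); first exact/measurable_EFinP.
by move=> x _ /=; rewrite lee_fin (le_trans (fc x)) ?ler_norm.
Qed.

Lemma integral_box_le (f : X -> R) c : measurable_fun setT f -> (forall x, 0 <= f x) ->
  0 <= c -> (forall x, f x <= c * b1 x) ->
  (\int[la]_x (f x)%:E <= c%:E * la (@box R d r))%E.
Proof.
move=> mf f0 c0 fc; have mb := @measurable_box R d r.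
rewrite -(setIT (box r)) -integral_indic// -ge0_integralZl//; last exact/measurable_EFinP.
apply: ge0_le_integral => //.
- by move=> x _; rewrite lee_fin.
- exact/measurable_EFinP.
- by apply: measurable_funeM; exact/measurable_EFinP.
- by move=> x _; rewrite -EFinM lee_fin.
Qed.

(* [G'] stands for [G (config_add x g, x)], which need not be measurable in [(g, x)]. *)
Lemma mecke_ge0 (G G' : config R d * X -> R) :
  measurable_fun setT G -> measurable_fun setT G' ->
  (forall p, 0 <= G p) -> (forall p, 0 <= G' p) ->
  (forall g x, ~ config_set g x -> G (config_add x g, x) = G' (g, x)) ->
  (\int[mu]_g (\esum_(x in g) (G (g, x))%:E) =
   \int[mu]_g \int[la]_x (a (g, x) * G' (g, x))%:E)%E.
Proof.
move=> mG mG' G0 G'0 GG'.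
have := mu_gibbs (F := EFin \o G); rewrite /= => -> //; first last.
  exact/measurable_EFinP.
apply: eq_integral => g _; apply: (integral_off_config (g := g)) => //.
  apply/measurable_EFinP.
  exact: (measurableT_comp (measurable_funM ma mG') (pair1_measurable g)).
by move=> x gx; rewrite GG'// EFinM intensityE.
Qed.

(** The Gibbs identity for the indicator of the box: the mean number of points is at most [z] times
    the volume. *)
Lemma integral_box_count : (\int[mu]_g (box_count g)%:E < +oo)%E.
Proof.
pose G (p : config R d * X) : R := b1 p.2.
have mG : measurable_fun setT G := measurableT_comp mbox1 measurable_snd.
have := @mecke_ge0 G G mG mG (fun=> box1_ge0 _) (fun=> box1_ge0 _) (fun _ _ _ => erefl).
rewrite (eq_integral (fun g => (box_count g)%:E)); last first.
  move=> g _; rewrite esum_fsum//.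
  by apply: (@finite_config_support R d g r (fun x => G (g, x))) => x; exact: box1_0.
move=> ->; apply: (@le_lt_trans _ _ (\int[mu]_g (z%:E * la (@box R d r)))%E).
  apply: ge0_le_integral => //.
  - by move=> g _; apply: integral_ge0 => x _; rewrite lee_fin mulr_ge0// intensity_ge0.
  - apply: (@measurable_fun_fubini_tonelli_F _ _ _ _ _ la (fun p => (a p * G p)%:E)) => //.
      by apply/measurable_EFinP; exact: measurable_funM.
    by move=> p; rewrite lee_fin mulr_ge0 ?intensity_ge0//; exact: box1_ge0.
  - move=> g _; apply: integral_box_le => //.
    + exact: (measurableT_comp (measurable_funM ma mG) (pair1_measurable g)).
    + by move=> x; rewrite mulr_ge0// intensity_ge0.
    + by move=> x; rewrite ler_wpM2r// intensity_le.
rewrite integral_cst// [X in (_ * X)%E](_ : _ = 1%E); last exact: probability_setT.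
by rewrite mule1 lte_mul_pinfty ?lee_fin//; exact: lebesgue_box.
Qed.

Lemma integrable_box_count : mu.-integrable setT (fun g => (box_count g)%:E).
Proof.
apply/integrableP; split; first by apply/measurable_EFinP; exact: measurable_box_count.
rewrite (eq_integral (fun g => (box_count g)%:E)); first exact: integral_box_count.
by move=> g _; rewrite gee0_abs// lee_fin box_count_ge0.
Qed.

Lemma integrable_le_box_count (f : config R d -> R) c : measurable_fun setT f ->
  (forall g, `|f g| <= c * (1 + box_count g)) -> mu.-integrable setT (EFin \o f).
Proof.
move=> mf fc; have i1 : mu.-integrable setT (EFin \o (fun g => 1 + box_count g)).
  rewrite (_ : EFin \o _ = (fun=> 1%:E) \+ (fun g => (box_count g)%:E))%E//.
  apply: integrableD => //.
    exact: finite_measure_integrable_cst.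
  exact: integrable_box_count.
apply: (le_integrable measurableT _ _ (integrableZl measurableT c i1)).
  exact/measurable_EFinP.
by move=> g _ /=; rewrite lee_fin (le_trans (fc g)) ?ler_norm.
Qed.

(* The Lebesgue integral of [a G'] is split along the sign of [G'], so that the
   identity reduces to the one for nonnegative functions. *)
Lemma mecke (G G' : config R d * X -> R) c :
  measurable_fun setT G -> measurable_fun setT G' -> 0 <= c ->
  (forall g x, r < `|x| -> G (g, x) = 0) ->
  (forall g x, ~ config_set g x -> G (config_add x g, x) = G' (g, x)) ->
  (forall g x, `|a (g, x) * G' (g, x)| <= c * (1 + box_count g) * b1 x) ->
  mu.-integrable setT (fun g => (\sum_(x \in config_set g) G (g, x))%:E) /\
  (\int[mu]_g (\sum_(x \in config_set g) G (g, x))%:E =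
   \int[mu]_g \int[la]_x (a (g, x) * G' (g, x))%:E)%E.
Proof.
move=> mG mG' c0 G0 GG' bG'.
(* The nonnegative case with integrability of both sides, to be applied to the positive parts of
   [G], [G'] and of [- G], [- G']. *)
have key (P P' : config R d * X -> R) :
  measurable_fun setT P -> measurable_fun setT P' ->
  (forall p, 0 <= P p) -> (forall p, 0 <= P' p) ->
  (forall g x, r < `|x| -> P (g, x) = 0) ->
  (forall g x, ~ config_set g x -> P (config_add x g, x) = P' (g, x)) ->
  (forall g x, `|a (g, x) * P' (g, x)| <= c * (1 + box_count g) * b1 x) ->
  [/\ mu.-integrable setT (fun g => (\sum_(x \in config_set g) P (g, x))%:E),
    mu.-integrable setT (fun g => \int[la]_x (a (g, x) * P' (g, x))%:E)%E &
  (\int[mu]_g (\sum_(x \in config_set g) P (g, x))%:E =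
   \int[mu]_g \int[la]_x (a (g, x) * P' (g, x))%:E)%E].
  move=> mP mP' P0 P'0 Ps PP' bP'.
  have aP'0 p : 0 <= a p * P' p by rewrite mulr_ge0// intensity_ge0.
  have maP' : measurable_fun setT (fun p => a p * P' p) by exact: measurable_funM.
  have sumE g : (\sum_(x \in config_set g) P (g, x))%:E = (\esum_(x in g) (P (g, x))%:E)%E.
    by rewrite esum_fsum//; exact: (@finite_config_support R d g r (fun x => P (g, x)) (Ps g)).
  have intE : (\int[mu]_g (\sum_(x \in config_set g) P (g, x))%:E =
   \int[mu]_g \int[la]_x (a (g, x) * P' (g, x))%:E)%E.
    by rewrite -(mecke_ge0 mP mP')//; apply: eq_integral => g _; exact: sumE.
  have mS : measurable_fun setT (fun g => \sum_(x \in config_set g) P (g, x)).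
    exact: measurable_config_sum_cst Ps.
  have mI : measurable_fun setT (fun g => \int[la]_x (a (g, x) * P' (g, x))%:E)%E.
    apply: (@measurable_fun_fubini_tonelli_F _ _ _ _ _ la (fun p => (a p * P' p)%:E)) => //.
      exact/measurable_EFinP.
  have I0 g : (0 <= \int[la]_x (a (g, x) * P' (g, x))%:E)%E.
    by apply: integral_ge0 => x _; rewrite lee_fin.
  (* Integrating the assumed bound over the box leaves a multiple of [1 + box_count g], which has a
     first moment. *)
  have iI : mu.-integrable setT (fun g => \int[la]_x (a (g, x) * P' (g, x))%:E)%E.
    have L0 : 0 <= c * fine (la (@box R d r)) by rewrite mulr_ge0// fine_ge0.
    have mN : measurable_fun setT (fun g => c * fine (la (@box R d r)) * (1 + box_count g)).
      apply: measurable_funM => //; apply: measurable_funD => //.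
      exact: measurable_box_count.
    have iN := @integrable_le_box_count _ (c * fine (la (@box R d r))) mN.
    apply: (le_integrable measurableT mI _ (iN _)) => [g _|g]; last first.
      by rewrite ger0_norm// mulr_ge0// addr_ge0// box_count_ge0.
    rewrite gee0_abs// gee0_abs; last by rewrite lee_fin mulr_ge0// addr_ge0// box_count_ge0.
    rewrite [(EFin \o _) g]/= mulrAC EFinM fineK ?ge0_fin_numE ?lebesgue_box//.
    apply: integral_box_le => //.
    + exact: (measurableT_comp maP' (pair1_measurable g)).
    + by rewrite mulr_ge0// addr_ge0// box_count_ge0.
    + by move=> x; apply: le_trans (bP' g x); exact: ler_norm.
  (* For nonnegative summands the identity itself transfers integrability from the Lebesgue side to
     the sum. *)
  split=> //; apply/integrableP; split; first exact/measurable_EFinP.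
  rewrite (eq_integral (fun g => (\sum_(x \in config_set g) P (g, x))%:E)).
    by rewrite intE; move/integrableP : iI => [_]; under eq_integral do rewrite gee0_abs//.
  by move=> g _; rewrite gee0_abs// lee_fin; apply: fsumr_ge0.
pose pos (H : config R d * X -> R) p := Num.max (H p) 0.
have mpos H : measurable_fun setT H -> measurable_fun setT (pos H).
  by move=> mH; apply: measurable_maxr.
have pos0 H p : 0 <= pos H p by rewrite le_max lexx orbT.
have pos_le H p : pos H p <= `|H p| by rewrite ge_max ler_norm normr_ge0.
have bpos H : (forall p, `|H p| = `|G' p|) ->
    forall g x, `|a (g, x) * pos H (g, x)| <= c * (1 + box_count g) * b1 x.
  move=> HG g x; apply: le_trans (bG' g x).
  by rewrite !normrM ler_wpM2l// ger0_norm// -HG.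
have posB H p : H p = pos H p - pos (fun p => - H p) p.
  rewrite /pos; have [H0|H0] := leP (H p) 0; first by rewrite max_l ?oppr_ge0// sub0r opprK.
  by rewrite max_r ?oppr_le0 ?ltW// subr0.
have mG'N : measurable_fun setT (fun p => - G' p) by exact: measurableT_comp.
have mGN : measurable_fun setT (fun p => - G p) by exact: measurableT_comp.
have [ip iIp Ep] : [/\ mu.-integrable setT (fun g => (\sum_(x \in config_set g) pos G (g, x))%:E),
    mu.-integrable setT (fun g => \int[la]_x (a (g, x) * pos G' (g, x))%:E)%E &
  (\int[mu]_g (\sum_(x \in config_set g) pos G (g, x))%:E =
   \int[mu]_g \int[la]_x (a (g, x) * pos G' (g, x))%:E)%E].
  apply: key => //; [exact: mpos|exact: mpos| | |exact: bpos].
    by move=> g x rx; rewrite /pos G0// maxxx.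
  by move=> g x gx; rewrite /pos GG'.
have [im iIm Em] : [/\ mu.-integrable setT
      (fun g => (\sum_(x \in config_set g) pos (fun p => - G p) (g, x))%:E),
    mu.-integrable setT (fun g => \int[la]_x (a (g, x) * pos (fun p => - G' p) (g, x))%:E)%E &
  (\int[mu]_g (\sum_(x \in config_set g) pos (fun p => - G p) (g, x))%:E =
   \int[mu]_g \int[la]_x (a (g, x) * pos (fun p => - G' p) (g, x))%:E)%E].
  apply: key => //; [exact: mpos|exact: mpos| | |].
  - by move=> g x rx; rewrite /pos G0// oppr0 maxxx.
  - by move=> g x gx; rewrite /pos GG'.
  - by apply: bpos => p; rewrite normrN.
have sE g : (\sum_(x \in config_set g) G (g, x))%:E =
    ((\sum_(x \in config_set g) pos G (g, x))%:E -
     (\sum_(x \in config_set g) pos (fun p => - G p) (g, x))%:E)%E.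
  have [s [_ _ ss]] := config_sum_seq g r.
  rewrite !ss; [|by move=> x rx; rewrite /pos G0// ?oppr0 ?maxxx..].
  by rewrite -EFinB -sumrB; congr EFin; apply: eq_bigr => x _; exact: posB.
have iE g : (\int[la]_x (a (g, x) * G' (g, x))%:E =
    \int[la]_x (a (g, x) * pos G' (g, x))%:E -
    \int[la]_x (a (g, x) * pos (fun p => - G' p) (g, x))%:E)%E.
  rewrite integralE; congr (_ - _)%E; apply: eq_integral => x _.
    by rewrite funeposE -EFin_max /pos maxr_pMr ?intensity_ge0// mulr0.
  by rewrite funenegE -EFinN -EFin_max /pos maxr_pMr ?intensity_ge0// mulr0 mulrN.
rewrite (funext sE) (funext iE); split; first exact: (integrableB measurableT ip im).
by rewrite (integralB measurableT ip im) (integralB measurableT iIp iIm) Ep Em.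
Qed.

Lemma box_count_add g x : ~ config_set g x ->
  box_count (config_add x g) = b1 x + box_count g.
Proof. by move=> gx; rewrite /box_count (@config_sum_add _ _ g x r b1)//; exact: box1_0. Qed.

(** With N = [box_count g], summing [G] over [g] gives N(N - 1); the [- 1] cancels the point that
    the Gibbs identity adds, so the other side involves only the first moment of N. Adding N then
    yields N^2. *)
Lemma integrable_box_count2 :
  mu.-integrable setT (fun g => (box_count g ^+ 2)%:E).
Proof.
pose G (p : config R d * X) : R := b1 p.2 * (box_count p.1 - 1).
pose G' (p : config R d * X) : R := b1 p.2 * box_count p.1.
have mb2 : measurable_fun setT (fun p : config R d * X => b1 p.2).
  exact: measurableT_comp mbox1 measurable_snd.
have mN1 : measurable_fun setT (fun p : config R d * X => box_count p.1).
  exact: measurableT_comp measurable_box_count measurable_fst.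
have [|||g x rx|g x gx|g x|iG _] := @mecke G G' z.
- by apply: measurable_funM => //; apply: measurable_funB.
- exact: measurable_funM.
- exact: z_ge0.
- by rewrite /G/= box1_0// mul0r.
- rewrite /G /G'/= box_count_add// mulrBr mulrDr mulr1 addrAC indicE.
  by case: (x \in _); rewrite ?mulr1 ?mul0r ?subrr ?add0r ?addr0 ?subr0.
- rewrite /G'/= mulrCA mulrC ger0_norm; last first.
    by rewrite mulr_ge0 ?box1_ge0// mulr_ge0 ?intensity_ge0 ?box_count_ge0//.
  rewrite ler_wpM2r// ler_pM ?intensity_ge0 ?box_count_ge0 ?intensity_le//.
  by rewrite lerDr.
have -> : (fun g => (box_count g ^+ 2)%:E) =
    ((fun g => (\sum_(x \in config_set g) G (g, x))%:E) \+ (fun g => (box_count g)%:E))%E.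
  apply/funext => g; rewrite -EFinD; congr EFin; rewrite {2}/box_count.
  have [s [_ _ ss]] := config_sum_seq g r.
  rewrite !ss//; last by move=> x rx; rewrite /G/= box1_0// mul0r.
  rewrite /G/= -mulr_suml {2}/box_count ss// mulrBr mulr1 subrK expr2.
  by rewrite {1 2}/box_count ss.
exact: (integrableD measurableT iG integrable_box_count).
Qed.

Lemma integrable_le_box_count2 (f : config R d -> R) c : measurable_fun setT f ->
  (forall g, `|f g| <= c * (1 + box_count g) ^+ 2) -> mu.-integrable setT (EFin \o f).
Proof.
move=> mf fc; have i1 : mu.-integrable setT (EFin \o (fun g => (1 + box_count g) ^+ 2)).
  have -> : EFin \o (fun g => (1 + box_count g) ^+ 2) =
      ((EFin \o (fun g => (1 + 2 * box_count g)%R)) \+ (fun g => (box_count g ^+ 2)%R%:E))%E.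
    by apply/funext => g /=; rewrite -EFinD; congr EFin; ring.
  apply: integrableD => //; last exact: integrable_box_count2.
  apply: (@integrable_le_box_count _ 2).
    apply: measurable_funD => //; apply: measurable_funM => //.
    exact: measurable_box_count.
  move=> g; have := box_count_ge0 g; move: (box_count g) => t t0.
  by rewrite ger0_norm; lra.
apply: (le_integrable measurableT _ _ (integrableZl measurableT c i1)).
  exact/measurable_EFinP.
by move=> g _ /=; rewrite lee_fin (le_trans (fc g)) ?ler_norm.
Qed.

End mecke.

(** * The finite algebraic identity and the passage from pairs to lists *)

Definition offdiag {R : realType} {d : nat} (x y : 'rV[R]_d) (c : R) : R :=
  if y == x then 0 else c.

(** To be read with [H] = F(g), [Q x] = F(g \ x), [P x y] = F(g \ {x,y}) and [k x y] = e^{phi(x-y)}.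
    Off the diagonal put a = Q x - H, b = Q y - H, u = P x y - Q x, v = P x y - Q y. The second
    difference is u - b = v - a, so its square is (u - b)(v - a) = u v + a b - a u - b v, while the
    terms in [k] agree on both sides. The diagonal contributes (Q x - H)^2 to each side. *)
Lemma square_sum_offdiag {R : realType} {d : nat} (l : seq 'rV[R]_d)
    (P k : 'rV[R]_d -> 'rV[R]_d -> R) (Q : 'rV[R]_d -> R) (H : R) :
  (forall x y, P x y = P y x) ->
  (\sum_(x <- l) (Q x - H)) ^+ 2 +
    \sum_(x <- l) \sum_(y <- l) offdiag x y (k x y * (P x y - Q y) * (P x y - Q x)) =
  \sum_(x <- l) \sum_(y <- l)
     (if y == x then - (Q x - H) else P x y - Q x - (Q y - H)) ^+ 2 +
  \sum_(x <- l) \sum_(y <- l)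
     offdiag x y ((k x y - 1) * ((P x y - Q x) * (P x y - Q y))) +
  2 * \sum_(x <- l) (Q x - H) * \sum_(y <- l) offdiag x y (P x y - Q x).
Proof.
move=> Psym; pose S x y := (Q x - H) * offdiag x y (P x y - Q x).
(* The factor 2 is shared between [(x, y)] and [(y, x)]; after this symmetrisation the two sides
   agree summand by summand. *)
have -> : 2 * \sum_(x <- l) (Q x - H) * \sum_(y <- l) offdiag x y (P x y - Q x) =
    \sum_(x <- l) \sum_(y <- l) (S x y + S y x).
  under [RHS]eq_bigr do rewrite big_split.
  rewrite big_split/= [X in _ = _ + X]exchange_big/= mulr_natl mulr2n.
  by congr (_ + _); apply: eq_bigr => x _; rewrite mulr_sumr.
rewrite expr2 big_distrlr/= -!big_split/=; apply: eq_bigr => x _.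
rewrite -!big_split/=; apply: eq_bigr => y _; rewrite /S /offdiag [x == y]eq_sym.
case: eqP => [->|_]; first by ring.
by rewrite (Psym y x); ring.
Qed.

Section pointwise.
Context {R : realType} {d : nat}.
Local Notation X := 'rV[R]_d.
Implicit Types g : config R d.

Lemma eq_ssum (T : choiceType) (D : set T) (u v : T -> \bar R) :
  (forall x, D x -> u x = v x) -> ssum D u = ssum D v.
Proof.
by move=> uv; rewrite /ssum; congr (_ - _)%E; apply: eq_esum => x Dx;
  rewrite ?funeposE ?funenegE uv.
Qed.

Lemma ssum_config g r (u : X -> R) : (forall x, r < `|x| -> u x = 0) ->
  ssum g (fun x => (u x)%:E) = (\sum_(x \in config_set g) u x)%:E.
Proof. by move=> u0; apply: ssum_fsum; exact: finite_config_support u0. Qed.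

(** [L] lists the ordered pairs of distinct points of the box; both sides reduce to it because [u]
    vanishes once either point leaves the box. *)
Lemma ssum_offdiag g r (l : seq X) (u : X -> X -> R) : uniq l ->
  (forall x, x \in l <-> config_set g x /\ `|x| <= r) ->
  (forall x y, r < `|x| \/ r < `|y| -> u x y = 0) ->
  ssum [set xy : X * X | [/\ config_set g xy.1, config_set g xy.2 & xy.1 != xy.2]]
    (fun xy => (u xy.1 xy.2)%:E) =
  (\sum_(x <- l) \sum_(y <- l) offdiag x y (u x y))%:E.
Proof.
move=> ul lP u0.
set D := [set xy : X * X | _].
pose L := [seq xy <- [seq (x, y) | x <- l, y <- l] | xy.1 != xy.2].
have uL : uniq L.
  by apply/filter_uniq/allpairs_uniq => // -[x y] [x' y'].
have LP xy : xy \in L -> D xy.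
  rewrite mem_filter => /andP[xy12 /allpairsP[[x y] [/= /lP[gx _] /lP[gy _] e]]].
  by rewrite e in xy12 *.
have DL xy : D xy -> ~ xy \in L -> u xy.1 xy.2 = 0.
  move=> [gx gy xy12] xyL; apply: u0; apply: contrapT => /not_orP[/negP rx /negP ry].
  apply: xyL; rewrite mem_filter xy12/=; case: xy gx gy rx ry xy12 => x y /= gx gy rx ry _.
  by apply/allpairsP; exists (x, y); split=> //=; apply/lP; split=> //; rewrite leNgt.
rewrite ssum_fsum; last first.
  apply: (sub_finite_set _ (finite_seq L)) => xy [Dxy /= uxy].
  by apply: contrapT => xyL; move/eqP: uxy; apply; exact: DL.
congr EFin; transitivity (\sum_(xy \in [set` L]) u xy.1 xy.2).
  by apply/esym/fsbig_widen => [//|xy [Dxy xyL]]; exact: DL.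
rewrite -fsbig_seq// /L big_filter big_mkcond big_allpairs/=.
apply: eq_bigr => x _; apply: eq_bigr => y _; rewrite /offdiag eq_sym.
by case: eqP.
Qed.

End pointwise.

(** * Cylinder functions *)

Section cylinder.
Context {R : realType} {d n : nat}.
Local Notation X := 'rV[R]_d.
Context (phi : X -> \bar R) (z r M : R) (mu : probability (config R d) R).
Context (h : 'rV[R]_n -> R) (f : 'I_n -> X -> R).
Hypothesis d_gt0 : (0 < d)%N.
Hypothesis phi_meas : measurable_fun setT phi.
Hypothesis phi_ge0 : forall x, (0 <= phi x)%E.
Hypothesis phi_fin : forall x, x != 0 -> phi x \is a fin_num.
Hypothesis z_ge0 : 0 <= z.
Hypothesis mu_gibbs : gibbs z phi mu.
Hypothesis h_cont : continuous h.
Hypothesis h_bound : forall v, `|h v| <= M.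
Hypothesis f_test : forall i, test_function (f i).
Hypothesis f_supp : forall i x, r < `|x| -> f i x = 0.
Implicit Types g : config R d.

Local Notation a := (intensity phi z).
Local Notation la := (@lebesgue_rV R d).
Local Notation b1 := (\1_(@box R d r) : X -> R).
Local Notation N := (box_count r).
Let ma := measurable_intensity z phi_meas phi_ge0.

Definition pairings g : 'rV[R]_n := \row_i pairing (f i) g.
(** The increment of [pairings] when the point [x] is added. *)
Definition tests (x : X) : 'rV[R]_n := \row_i f i x.
Local Notation s := pairings.
Local Notation t := tests.

Lemma tests0 x : r < `|x| -> t x = 0.
Proof. by move=> rx; apply/rowP => i; rewrite !mxE f_supp. Qed.

Lemma pairings_add x g : ~ config_set g x -> s (config_add x g) = s g + t x.
Proof.
move=> gx; apply/rowP => i; rewrite !mxE /pairing.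
by rewrite (@config_sum_add _ _ g x r (f i) gx (f_supp i)) addrC.
Qed.

Lemma pairings_del x g : config_set g x -> s (config_del g [set x]) = s g - t x.
Proof.
move=> gx; rewrite -[in RHS](config_del_add gx) pairings_add ?addrK//.
by move=> [_ /=]; apply.
Qed.

Lemma measurable_pairings : measurable_fun setT s.
Proof.
apply: measurable_fun_rV => i; apply: eq_measurable_fun (measurable_pairing (f_test i)).
by move=> g _; rewrite mxE.
Qed.

Lemma measurable_tests : measurable_fun setT t.
Proof.
apply: measurable_fun_rV => i.
have [cf _] := f_test i.
by apply: eq_measurable_fun (continuous_measurable_rV cf) => x _; rewrite mxE.
Qed.

Let mh := continuous_measurable_rV h_cont.

Let b1E (x : X) : b1 x = (`|x| <= r)%R%:R.
Proof.
rewrite indicE; congr (nat_of_bool _)%:R.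
by apply/idP/idP => [/set_mem|?]; [|exact: mem_set].
Qed.

Let M_ge0 : 0 <= M.
Proof. by rewrite (le_trans _ (h_bound 0)). Qed.

Let h_diff v w : `|h v - h w| <= 2 * M.
Proof. by have := ler_normB (h v) (h w); have := h_bound v; have := h_bound w; lra. Qed.

(* [h] is only ever tested against increments by [t x], which vanish off the box. *)
Let h_diff_box v w x : (r < `|x| -> v = w) -> `|h v - h w| <= 2 * M * b1 x.
Proof.
rewrite b1E; case: (leP `|x| r) => [_ _|rx ->//]; first by rewrite mulr1.
by rewrite subrr normr0 mulr0.
Qed.

(* [D^-_x F] for [x] in [g] and [D^+_x F] for [x] not in [g], as functions of
   [pairings g]: this makes them jointly measurable in [(g, x)]. *)
Definition dminus g x := h (s g - t x) - h (s g).
Definition dplus g x := h (s g) - h (s g + t x).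
Definition sum_dminus g := \sum_(x \in config_set g) dminus g x.
Definition int_dplus g := \int[la]_x (a (g, x) * dplus g x).
(* [e^phi] with the value at [0], where [phi] may be [+oo], replaced by [1]: the
   bound [intensity_weight_le] then holds for all [x]. *)
Definition weight (x : X) : R := if x == 0 then 1 else expR (fine (phi x)).

Lemma measurable_weight : measurable_fun setT weight.
Proof.
apply: measurable_fun_ifT => //.
  apply: (measurable_fun_bool true).
  rewrite (_ : _ @^-1` _ = ([set 0] : set X)); first by rewrite setTI; exact: measurable_set1_rV.
  by apply/seteqP; split=> x /= /eqP.
apply: measurableT_comp => //; exact: measurableT_comp.
Qed.

Lemma weight_ge0 x : 0 <= weight x.
Proof. by rewrite /weight; case: ifP => // _; exact: expR_ge0. Qed.

Lemma intensity_weight_le g x y : config_set g y -> a (g, x) * weight (x - y) <= z.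
Proof.
move=> gy; rewrite /weight; case: ifPn => [_|/phi_fin fin].
  by rewrite mulr1 intensity_le.
exact: intensity_expR_le.
Qed.

Lemma intensity_weight_add g x y : ~ config_set g y -> x != y ->
  a (config_add y g, x) * weight (x - y) = a (g, x).
Proof.
move=> gy xy; rewrite /weight subr_eq0 (negbTE xy) intensity_addK//.
by apply: phi_fin; rewrite subr_eq0.
Qed.

Lemma dminus_le g x : `|dminus g x| <= 2 * M * b1 x.
Proof. by apply: h_diff_box => /tests0 ->; rewrite subr0. Qed.

Lemma dplus_le g x : `|dplus g x| <= 2 * M * b1 x.
Proof. by apply: h_diff_box => /tests0 ->; rewrite addr0. Qed.

Lemma dminus0 g x : r < `|x| -> dminus g x = 0.
Proof. by move=> rx; rewrite /dminus tests0// subr0 subrr. Qed.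

Lemma dminus_add g x : ~ config_set g x -> dminus (config_add x g) x = dplus g x.
Proof. by move=> gx; rewrite /dminus pairings_add// addrK. Qed.

Section measurability_cylinder.
Context dT (T : measurableType dT).
Context (u : T -> config R d) (v w : T -> X).
Hypotheses (meas_u : measurable_fun setT u) (mv : measurable_fun setT v)
  (mw : measurable_fun setT w).

Lemma measurable_s : measurable_fun setT (fun p => s (u p)).
Proof. exact: measurableT_comp measurable_pairings meas_u. Qed.

Lemma measurable_t : measurable_fun setT (fun p => t (v p)).
Proof. exact: measurableT_comp measurable_tests mv. Qed.

Lemma measurable_h (k : T -> 'rV[R]_n) : measurable_fun setT k ->
  measurable_fun setT (fun p => h (k p)).
Proof. exact: measurableT_comp. Qed.

Lemma measurable_dminus : measurable_fun setT (fun p => dminus (u p) (v p)).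
Proof.
by apply: measurable_funB; apply: measurable_h; [apply: measurable_funB_rV|];
  [exact: measurable_s|exact: measurable_t|exact: measurable_s].
Qed.

Lemma measurable_dplus : measurable_fun setT (fun p => dplus (u p) (v p)).
Proof.
by apply: measurable_funB; apply: measurable_h; [|apply: measurable_funD_rV];
  [exact: measurable_s|exact: measurable_s|exact: measurable_t].
Qed.

Lemma measurable_intensity_comp : measurable_fun setT (fun p => a (u p, v p)).
Proof. by apply: (measurableT_comp ma); exact: measurable_fun_pair. Qed.

Lemma measurable_weight_comp : measurable_fun setT (fun p => weight (v p - w p)).
Proof. by apply: (measurableT_comp measurable_weight); exact: measurable_funB_rV. Qed.

Lemma measurable_eq_rV : measurable_fun setT (fun p => v p == w p).
Proof.
apply: (measurable_fun_bool true).
rewrite (_ : _ @^-1` _ = (fun p => v p - w p) @^-1` [set 0]).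
  by apply: measurable_funB_rV => //; exact: measurable_set1_rV.
apply/seteqP; split=> x /=; first by move/eqP => ->; rewrite subrr.
by move/eqP; rewrite subr_eq0.
Qed.

End measurability_cylinder.

Lemma measurable_sum_dminus : measurable_fun setT sum_dminus.
Proof.
apply: (@measurable_config_sum_cst R d (fun p => dminus p.1 p.2) r).
  by apply: measurable_dminus; [exact: measurable_fst|exact: measurable_snd].
exact: dminus0.
Qed.

Lemma measurable_int_dplus : measurable_fun setT int_dplus.
Proof.
apply: (@measurable_integral_param R d _ _ (fun p => a p * dplus p.1 p.2)).
apply: measurable_funM => //.
by apply: measurable_dplus; [exact: measurable_fst|exact: measurable_snd].
Qed.

Lemma sum_dminus_le g : `|sum_dminus g| <= 2 * M * N g.
Proof.
have [l [_ _ ll]] := config_sum_seq g r.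
rewrite /sum_dminus /box_count !ll//; last 2 first.
- by move=> x rx; rewrite b1E leNgt rx.
- exact: dminus0.
rewrite mulr_sumr; apply: le_trans (ler_norm_sum _ _ _) _.
by apply: ler_sum => x _; exact: dminus_le.
Qed.

Lemma intensity_dplus_le g x : `|a (g, x) * dplus g x| <= z * (2 * M) * b1 x.
Proof.
rewrite normrM -mulrA ler_pM// ?dplus_le// ger0_norm ?intensity_ge0//.
exact: intensity_le.
Qed.

Lemma integrable_intensity_dplus g :
  la.-integrable setT (fun x => (a (g, x) * dplus g x)%:E).
Proof.
apply: (@integrable_box R d r _ (z * (2 * M))) => [|x]; last exact: intensity_dplus_le.
apply: measurable_funM; first exact: (measurableT_comp ma (pair1_measurable g)).
by apply: measurable_dplus => //; exact: measurable_cst.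
Qed.

Lemma int_dplusE g : (\int[la]_x (a (g, x) * dplus g x)%:E = (int_dplus g)%:E)%E.
Proof.
rewrite /int_dplus /Rintegral fineK//.
exact: integrable_fin_num (integrable_intensity_dplus g).
Qed.

(** Unlike the bound on [sum_dminus], this one is uniform in [g]: the intensity is at most [z] and
    [dplus] vanishes off the box. *)
Lemma int_dplus_le g : `|int_dplus g| <= z * (2 * M) * fine (la (@box R d r)).
Proof.
rewrite -lee_fin EFinM fineK; last by rewrite ge0_fin_numE// lebesgue_box.
have mf : measurable_fun setT (fun x => a (g, x) * dplus g x).
  by have /integrableP[/measurable_EFinP] := integrable_intensity_dplus g.
rewrite -abse_EFin -int_dplusE; apply: le_trans (le_abse_integral la measurableT _) _.
  exact/measurable_EFinP.
apply: integral_box_le => //; last by move=> x; exact: intensity_dplus_le.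
- exact: measurableT_comp.
- by rewrite !mulr_ge0.
Qed.

(** * The three sums S1, S2, S3 and their expectations *)

Definition kernel1 g x y := offdiag x y (h (s g - t x - t y) - h (s g - t x)).
(** For [y] in [g] and [x] different from [y], the first two factors form the intensity at g \ y and
    the last one is [dplus] there, so the integral over [x] is A(g \ y). Writing it at [g] keeps it
    jointly measurable. *)
Definition kernel2 g x y := a (g, x) * weight (x - y) * (h (s g - t y) - h (s g - t y + t x)).
Definition kernel3 g x y := offdiag x y (weight (x - y) *
  (h (s g - t x - t y) - h (s g - t y)) * (h (s g - t x - t y) - h (s g - t x))).
Definition kernel3_add g x y := weight (x - y) *
  (h (s g - t y) - h (s g - t y + t x)) * dminus g y.

(* The summands of S1, S2, S3; [term3_add] is [term3] at [config_add x g]. *)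
Definition term1 g x := dminus g x * \sum_(y \in config_set g) kernel1 g x y.
Definition term2 g y := dminus g y * \int[la]_x kernel2 g x y.
Definition term3 g x := \sum_(y \in config_set g) kernel3 g x y.
Definition term3_add g x := \sum_(y \in config_set g) kernel3_add g x y.

Lemma kernel1_0 g x y : r < `|y| -> kernel1 g x y = 0.
Proof. by move=> /tests0 ty; rewrite /kernel1 ty subr0 subrr /offdiag if_same. Qed.

Lemma kernel3_0 g x y : r < `|y| -> kernel3 g x y = 0.
Proof.
by move=> /tests0 ty; rewrite /kernel3 ty subr0 subrr mulr0 /offdiag if_same.
Qed.

Lemma kernel3_add0 g x y : r < `|y| -> kernel3_add g x y = 0.
Proof. by move=> /dminus0 dy; rewrite /kernel3_add dy mulr0. Qed.

Lemma term3_0 g x : r < `|x| -> term3 g x = 0.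
Proof.
move=> /tests0 tx; rewrite /term3 fsbig1// => y _.
by rewrite /kernel3 tx subr0 subrr mulr0 mul0r /offdiag if_same.
Qed.

Section measurable_kernels.
Context dT (T : measurableType dT) (u : T -> config R d) (v w : T -> X).
Hypotheses (meas_u : measurable_fun setT u) (mv : measurable_fun setT v)
  (mw : measurable_fun setT w).

Lemma measurable_offdiag (c : T -> R) : measurable_fun setT c ->
  measurable_fun setT (fun p => offdiag (v p) (w p) (c p)).
Proof.
by move=> mc; apply: measurable_fun_ifT => //; exact: measurable_eq_rV.
Qed.

Let ms := measurable_s meas_u.
Let mtv := measurable_t mv.
Let mtw := measurable_t mw.
Let msv := measurable_funB_rV ms mtv.
Let msw := measurable_funB_rV ms mtw.

Lemma measurable_kernel1 : measurable_fun setT (fun p => kernel1 (u p) (v p) (w p)).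
Proof.
apply: measurable_offdiag; apply: measurable_funB; apply: measurable_h => //.
exact: measurable_funB_rV.
Qed.

Lemma measurable_kernel2 : measurable_fun setT (fun p => kernel2 (u p) (v p) (w p)).
Proof.
apply: measurable_funM; last first.
  by apply: measurable_funB; apply: measurable_h => //; exact: measurable_funD_rV.
by apply: measurable_funM; [exact: measurable_intensity_comp|exact: measurable_weight_comp].
Qed.

Lemma measurable_kernel3 : measurable_fun setT (fun p => kernel3 (u p) (v p) (w p)).
Proof.
have mvw : measurable_fun setT (fun p => h (s (u p) - t (v p) - t (w p))).
  by apply: measurable_h; exact: measurable_funB_rV.
apply: measurable_offdiag; apply: measurable_funM; last first.
  by apply: measurable_funB => //; exact: measurable_h.
apply: measurable_funM; first exact: measurable_weight_comp.
by apply: measurable_funB => //; exact: measurable_h.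
Qed.

Lemma measurable_kernel3_add : measurable_fun setT (fun p => kernel3_add (u p) (v p) (w p)).
Proof.
apply: measurable_funM; last exact: measurable_dminus.
apply: measurable_funM; first exact: measurable_weight_comp.
by apply: measurable_funB; apply: measurable_h => //; exact: measurable_funD_rV.
Qed.

End measurable_kernels.

Let mu1 : measurable_fun setT (fun q : (config R d * X) * X => q.1.1).
Proof. exact: (measurableT_comp measurable_fst measurable_fst). Qed.

Let mv1 : measurable_fun setT (fun q : (config R d * X) * X => q.1.2).
Proof. exact: (measurableT_comp measurable_snd measurable_fst). Qed.

Let mw1 : measurable_fun setT (fun q : (config R d * X) * X => q.2).
Proof. exact: measurable_snd. Qed.

Let mdm : measurable_fun setT (fun p : config R d * X => dminus p.1 p.2).
Proof. by apply: measurable_dminus; [exact: measurable_fst|exact: measurable_snd]. Qed.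

Let mdp : measurable_fun setT (fun p : config R d * X => dplus p.1 p.2).
Proof. by apply: measurable_dplus; [exact: measurable_fst|exact: measurable_snd]. Qed.

Lemma measurable_term1 : measurable_fun setT (fun p : config R d * X => term1 p.1 p.2).
Proof.
apply: measurable_funM => //.
apply: (@measurable_config_sum R d _ _ (fun q => kernel1 q.1.1 q.1.2 q.2) r).
  exact: measurable_kernel1.
by move=> p x; exact: kernel1_0.
Qed.

Lemma measurable_term2 : measurable_fun setT (fun p : config R d * X => term2 p.1 p.2).
Proof.
apply: measurable_funM => //.
apply: (@measurable_integral_param R d _ _ (fun q => kernel2 q.1.1 q.2 q.1.2)).
exact: measurable_kernel2.
Qed.

Lemma measurable_term3 : measurable_fun setT (fun p : config R d * X => term3 p.1 p.2).
Proof.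
apply: (@measurable_config_sum R d _ _ (fun q => kernel3 q.1.1 q.1.2 q.2) r).
  exact: measurable_kernel3.
by move=> p x; exact: kernel3_0.
Qed.

Lemma measurable_term3_add :
  measurable_fun setT (fun p : config R d * X => term3_add p.1 p.2).
Proof.
apply: (@measurable_config_sum R d _ _ (fun q => kernel3_add q.1.1 q.1.2 q.2) r).
  exact: measurable_kernel3_add.
by move=> p x; exact: kernel3_add0.
Qed.

(** Adding [x] cancels the shift by [- t x], so each summand becomes [dminus g y]; [offdiag]
    discards [y = x], and what remains is the sum over [g] alone. *)
Lemma term1_add g x : ~ config_set g x -> term1 (config_add x g) x = dplus g x * sum_dminus g.
Proof.
move=> gx; rewrite /term1 dminus_add//; congr (_ * _).
rewrite (@config_sum_add _ _ g x r)//; last exact: kernel1_0.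
rewrite {1}/kernel1 /offdiag eqxx add0r; apply: eq_fsbigr => y /set_mem gy.
rewrite /kernel1 /offdiag; case: eqP => [yx|_]; first by rewrite -yx in gx.
by rewrite pairings_add// addrK.
Qed.

(** The weight undoes the contribution of [y] to the intensity, so the inner integral becomes A(g).
    The integrands may differ at [x] in [config_add y g], a null set. *)
Lemma term2_add g y : ~ config_set g y -> term2 (config_add y g) y = dplus g y * int_dplus g.
Proof.
move=> gy; rewrite /term2 dminus_add//; congr (_ * _).
rewrite /int_dplus /Rintegral; congr fine.
apply: (@integral_off_config R d (config_add y g)) => //.
  apply/measurable_EFinP; apply: measurable_funM.
    exact: (measurableT_comp ma (pair1_measurable g)).
  exact: (measurableT_comp mdp (pair1_measurable g)).
move=> x gyx; have xy : x != y by apply/eqP => xy; apply: gyx; left.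
by rewrite /kernel2 intensity_weight_add// pairings_add// addrK.
Qed.

Lemma term3E g x : ~ config_set g x -> term3 (config_add x g) x = term3_add g x.
Proof.
move=> gx; rewrite /term3 (@config_sum_add _ _ g x r)//; last exact: kernel3_0.
rewrite {1}/kernel3 /offdiag eqxx add0r; apply: eq_fsbigr => y /set_mem gy.
rewrite /kernel3 /kernel3_add /offdiag; case: eqP => [yx|_]; first by rewrite -yx in gx.
by rewrite pairings_add// addrK [s g + t x - t y]addrAC.
Qed.

Let cA : R := z * (2 * M) * fine (la (@box R d r)).

Let cA_ge0 : 0 <= cA.
Proof. by rewrite !mulr_ge0// fine_ge0. Qed.

(** The inner integral factors because B does not depend on the integration variable. The constant
    is the bound [z * (2 * M)] for the integrand of A times the bound [2 * M] for each summand of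
    B. *)
Lemma expectation_term1 :
  mu.-integrable setT (fun g => (\sum_(x \in config_set g) term1 g x)%:E) /\
  (\int[mu]_g (\sum_(x \in config_set g) term1 g x)%:E =
   \int[mu]_g (int_dplus g * sum_dminus g)%:E)%E.
Proof.
have [|||g x rx|g x gx|g x|i1 ->] := @mecke R d phi z r mu d_gt0 phi_meas phi_ge0 z_ge0 mu_gibbs
  (fun p => term1 p.1 p.2) (fun p => dplus p.1 p.2 * sum_dminus p.1) (z * (2 * M) * (2 * M)).
- exact: measurable_term1.
- by apply: measurable_funM => //; exact: (measurableT_comp measurable_sum_dminus measurable_fst).
- by rewrite !mulr_ge0.
- by rewrite /= /term1 dminus0// mul0r.
- exact: term1_add.
- rewrite /= mulrA normrM.
  apply: (le_trans (ler_pM _ _ (intensity_dplus_le g x) (sum_dminus_le g))) => //.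
  have -> : z * (2 * M) * b1 x * (2 * M * N g) = z * (2 * M) * (2 * M) * N g * b1 x by ring.
  by rewrite ler_wpM2r// ler_wpM2l ?lerDr// !mulr_ge0.
split=> //; apply: eq_integral => g _ /=.
under eq_integral do rewrite mulrA EFinM.
by rewrite (integralZr measurableT (integrable_intensity_dplus g)) int_dplusE.
Qed.

(** The same factorisation, now with A(g) pulled out, produces the square; [cA] is the uniform bound
    on A. *)
Lemma expectation_term2 :
  (\int[mu]_g (\sum_(x \in config_set g) term2 g x)%:E = \int[mu]_g (int_dplus g ^+ 2)%:E)%E.
Proof.
have [|||g x rx|g x gx|g x|_ ->] := @mecke R d phi z r mu d_gt0 phi_meas phi_ge0 z_ge0 mu_gibbs
  (fun p => term2 p.1 p.2) (fun p => dplus p.1 p.2 * int_dplus p.1) (z * (2 * M) * cA).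
- exact: measurable_term2.
- by apply: measurable_funM => //; exact: (measurableT_comp measurable_int_dplus measurable_fst).
- by rewrite mulr_ge0 ?cA_ge0// mulr_ge0// mulr_ge0.
- by rewrite /= /term2 dminus0// mul0r.
- exact: term2_add.
- rewrite /= mulrA normrM.
  apply: (le_trans (ler_pM _ _ (intensity_dplus_le g x) (int_dplus_le g))) => //.
  rewrite -/cA; have -> : z * (2 * M) * b1 x * cA = z * (2 * M) * cA * 1 * b1 x by ring.
  by rewrite ler_wpM2r// ler_wpM2l ?lerDl ?box_count_ge0// mulr_ge0 ?cA_ge0// mulr_ge0// mulr_ge0.
apply: eq_integral => g _ /=.
under eq_integral do rewrite mulrA EFinM.
by rewrite (integralZr measurableT (integrable_intensity_dplus g)) int_dplusE.
Qed.

Lemma kernel2_le g x y : config_set g y -> `|kernel2 g x y| <= z * (2 * M) * b1 x.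
Proof.
move=> gy; rewrite /kernel2 normrM -mulrA.
apply: ler_pM => //; last by apply: h_diff_box => /tests0 ->; rewrite addr0.
by rewrite ger0_norm ?intensity_weight_le// mulr_ge0 ?intensity_ge0 ?weight_ge0.
Qed.

Lemma integrable_kernel2 g y : config_set g y ->
  la.-integrable setT (fun x => (kernel2 g x y)%:E).
Proof.
move=> gy; apply: (@integrable_box R d r _ (z * (2 * M))) => [|x]; last exact: kernel2_le.
by apply: measurable_kernel2 => //; exact: measurable_cst.
Qed.

Lemma kernel3_addE g x y : a (g, x) * kernel3_add g x y = kernel2 g x y * dminus g y.
Proof. by rewrite /kernel3_add /kernel2 !mulrA. Qed.

(** The Gibbs identity for S3 leaves a sum over [y] inside an integral over [x]. Exchanging the two
    and pulling out [dminus g y] gives S2, ready for a second use of the identity. *)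
Lemma int_term3_add g :
  (\int[la]_x (a (g, x) * term3_add g x)%:E = (\sum_(y \in config_set g) term2 g y)%:E)%E.
Proof.
have [l [_ lP ll]] := config_sum_seq g r.
rewrite ll; last by move=> y ry; rewrite /term2 dminus0// mul0r.
(* Integrability is known only for [y] in [g], while the interchange asks for it at every index;
   hence the value 0 off [l]. *)
pose K y : X -> \bar R :=
  if y \in l then fun x => (a (g, x) * kernel3_add g x y)%:E else cst 0%E.
have iK y : la.-integrable setT (K y).
  rewrite /K; case: ifPn => [/lP[gy _]|_]; last exact: integrable0.
  have -> : (fun x => (a (g, x) * kernel3_add g x y)%:E) =
      (fun x => (kernel2 g x y)%:E * (dminus g y)%:E)%E.
    by apply/funext => x; rewrite kernel3_addE EFinM.
  exact: (integrableZr measurableT _ (integrable_kernel2 gy)).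
rewrite (eq_integral (fun x => \sum_(y <- l) K y x)%E); last first.
  move=> x _; rewrite /term3_add ll; last by move=> y; exact: kernel3_add0.
  by rewrite mulr_sumr -sumEFin; apply: eq_big_seq => y yl; rewrite /K yl.
rewrite (integral_sum measurableT iK) -sumEFin; apply: eq_big_seq => y yl.
have /lP[gy _] := yl; have i2 := integrable_kernel2 gy.
rewrite /K yl /term2 /Rintegral mulrC EFinM fineK; last exact: integrable_fin_num i2.
under eq_integral do rewrite kernel3_addE EFinM.
by rewrite (integralZr measurableT i2).
Qed.

Lemma expectation_term3 :
  mu.-integrable setT (fun g => (\sum_(x \in config_set g) term3 g x)%:E) /\
  (\int[mu]_g (\sum_(x \in config_set g) term3 g x)%:E = \int[mu]_g (int_dplus g ^+ 2)%:E)%E.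
Proof.
have [|||g x rx|g x gx|g x|i3 ->] := @mecke R d phi z r mu d_gt0 phi_meas phi_ge0 z_ge0 mu_gibbs
  (fun p => term3 p.1 p.2) (fun p => term3_add p.1 p.2) (z * (2 * M) * (2 * M)).
- exact: measurable_term3.
- exact: measurable_term3_add.
- by rewrite !mulr_ge0.
- exact: term3_0.
- exact: term3E.
- have [l [_ lP ll]] := config_sum_seq g r.
  rewrite /term3_add ll; last by move=> y; exact: kernel3_add0.
  rewrite /box_count ll; last by move=> y ry; rewrite b1E leNgt ry.
  rewrite mulr_sumr; apply: le_trans (ler_norm_sum _ _ _) _.
  (* Only points of [g] occur in [l], so intensity times weight is at most [z]; each of the two
     increments of [h] costs [2 * M]. *)
  apply: (@le_trans _ _ (\sum_(y <- l) z * (2 * M) * (2 * M * b1 y) * b1 x)).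
    rewrite big_seq [leRHS]big_seq; apply: ler_sum => y /lP[gy _].
    rewrite kernel3_addE normrM mulrAC.
    by apply: ler_pM; [| |exact: kernel2_le|exact: dminus_le].
  rewrite -mulr_suml ler_wpM2r// -mulr_sumr -mulr_sumr mulrA ler_wpM2l ?mulr_ge0//.
  by rewrite lerDr.
split=> //; rewrite -expectation_term2.
by apply: eq_integral => g _; exact: int_term3_add.
Qed.

(** * The pointwise identity for a cylinder function *)

Definition cylinder g := h (pairings g).
Local Notation F := cylinder.

Lemma cylinder_del g x : config_set g x -> F (config_del g [set x]) = h (s g - t x).
Proof. by move=> gx; rewrite /cylinder pairings_del. Qed.

Lemma cylinder_del_del g x y : config_set g x -> config_set g y -> x != y ->
  F (config_del (config_del g [set x]) [set y]) = h (s g - t x - t y).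
Proof.
move=> gx gy xy; rewrite /cylinder pairings_del ?pairings_del//.
by split=> //= yx; rewrite yx eqxx in xy.
Qed.

Lemma cylinder_del2 g x y : config_set g x -> config_set g y -> x != y ->
  F (config_del g [set x; y]) = h (s g - t x - t y).
Proof.
move=> gx gy xy; rewrite -cylinder_del_del//; congr cylinder; apply: config_eq.
by rewrite /= setDDl.
Qed.

Lemma DminusE g x : config_set g x -> Dminus x F g = dminus g x.
Proof. by move=> gx; rewrite /Dminus cylinder_del. Qed.

Lemma generatorHE g : generatorH z phi F g = (int_dplus g - sum_dminus g)%:E.
Proof.
rewrite /generatorH EFinB -int_dplusE; congr (_ - _)%E.
  apply: (@integral_off_config R d g) => //.
    by have /integrableP[] := integrable_intensity_dplus g.
  by move=> x gx; rewrite EFinM intensityE// /Dplus /cylinder pairings_add.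
rewrite -(@ssum_config R d g r); last exact: dminus0.
by apply: eq_ssum => x gx; rewrite DminusE.
Qed.

Definition dminus2 g x y :=
  if y == x then - dminus g x else h (s g - t x - t y) - h (s g - t x) - dminus g y.

(** On the diagonal the second deletion of [x] changes nothing, which leaves - D^-_x F. *)
Lemma Dminus2E g x y : config_set g x -> config_set g y ->
  Dminus2 F g x y = (dminus2 g x y)%:E.
Proof.
move=> gx gy; rewrite /Dminus2 /dminus2 /Dminus; congr EFin.
have [->|yx] := eqVneq y x.
  rewrite (_ : config_del (config_del g _) _ = config_del g [set x]).
    by rewrite subrr sub0r cylinder_del.
  by apply: config_eq; rewrite /= setDDl setUid.
by rewrite cylinder_del_del 1?eq_sym// !cylinder_del.
Qed.

Lemma dminus2_0 g x y : r < `|x| \/ r < `|y| -> dminus2 g x y = 0.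
Proof.
rewrite /dminus2; case: eqP => [->|_].
  by case=> rx; rewrite dminus0 ?oppr0.
case=> [/tests0 tx|ry]; first by rewrite tx [s g - 0]subr0 subrr.
by rewrite dminus0// (tests0 ry) !subr0 subrr.
Qed.

Definition interaction g x y := (weight (x - y) - 1) *
  ((h (s g - t x - t y) - h (s g - t x)) * (h (s g - t x - t y) - h (s g - t y))).

(** For distinct points [phi (x - y)] is finite and [weight] is the true exponential. *)
Lemma interactionE g x y : config_set g x -> config_set g y -> x != y ->
  ((expeR (phi (x - y)%R) - 1) *
    ((F (config_del g [set x; y]) - F (config_del g [set x])) *
     (F (config_del g [set x; y]) - F (config_del g [set y])))%R%:E =
  (interaction g x y)%:E)%E.
Proof.
move=> gx gy xy; rewrite cylinder_del2// !cylinder_del// /interaction /weight.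
rewrite subr_eq0 (negbTE xy) [RHS]EFinM; congr (_ * _)%E.
by rewrite -[phi _]fineK//; apply: phi_fin; rewrite subr_eq0.
Qed.

Lemma interaction0 g x y : r < `|x| \/ r < `|y| -> interaction g x y = 0.
Proof.
case=> /tests0 t0; rewrite /interaction t0.
  by rewrite [s g - 0]subr0 subrr !mulr0.
by rewrite [s g - t x - 0]subr0 subrr mul0r mulr0.
Qed.

Lemma op_trace_Dminus2 g (l : seq X) : uniq l ->
  (forall x, x \in l <-> config_set g x /\ `|x| <= r) ->
  (forall u : X -> R, (forall x, r < `|x| -> u x = 0) ->
    \sum_(x \in config_set g) u x = \sum_(x <- l) u x) ->
  op_trace g (op_comp g (Dminus2 F g) (op_adjoint (Dminus2 F g))) =
  (\sum_(x <- l) \sum_(y <- l) dminus2 g x y ^+ 2)%:E.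
Proof.
move=> ul lP ll; rewrite /op_trace /op_comp /op_adjoint.
have d0 x y : r < `|x| \/ r < `|y| -> dminus2 g x y ^+ 2 = 0.
  by move=> /dminus2_0 ->; rewrite expr0n.
rewrite (@eq_ssum R _ _ _ (fun x => (\sum_(y <- l) dminus2 g x y ^+ 2)%:E)).
  rewrite (@ssum_config R d g r) ?ll//.
    by move=> x rx; rewrite big1// => y _; apply: d0; left.
  by move=> x rx; rewrite big1// => y _; apply: d0; left.
move=> x gx; rewrite -ll; last by move=> y ry; apply: d0; right.
rewrite -(@ssum_config R d g r); last by move=> y ry; apply: d0; right.
by apply: eq_ssum => y gy; rewrite Dminus2E// -EFinM -expr2.
Qed.

(** The right side is grouped for integration: the first square is (HF)^2, and the other two groups
    have mean zero by the expectations of S3 and S1. *)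
Lemma coercivity_pointwise g :
  (op_trace g (op_comp g (Dminus2 F g) (op_adjoint (Dminus2 F g)))
   + ssum [set xy : X * X | [/\ config_set g xy.1, config_set g xy.2 & xy.1 != xy.2]]
       (fun xy => (expeR (phi (xy.1 - xy.2)%R) - 1)
          * ((F (config_del g [set xy.1; xy.2]) - F (config_del g [set xy.1]))
           * (F (config_del g [set xy.1; xy.2]) - F (config_del g [set xy.2])))%R%:E))%E =
  ((int_dplus g - sum_dminus g) ^+ 2
   + (\sum_(x \in config_set g) term3 g x - int_dplus g ^+ 2)
   + 2 * (int_dplus g * sum_dminus g - \sum_(x \in config_set g) term1 g x))%:E.
Proof.
have [l [ul lP ll]] := config_sum_seq g r.
rewrite (op_trace_Dminus2 ul lP ll).
rewrite (@eq_ssum R _ _ _ (fun xy => (interaction g xy.1 xy.2)%:E)); last first.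
  by move=> [x y] [/= gx gy xy]; exact: interactionE.
rewrite (ssum_offdiag ul lP (@interaction0 g)) -EFinD; congr EFin.
have := @square_sum_offdiag R d l (fun x y => h (s g - t x - t y))
  (fun x y => weight (x - y)) (fun x => h (s g - t x)) (h (s g)).
move=> /(_ (fun x y => congr1 h (addrAC _ _ _))).
rewrite -/(dminus2 g) -/(sum_dminus g) /sum_dminus !ll; first last.
- exact: dminus0.
- exact: term3_0.
- by move=> x rx; rewrite /term1 dminus0// mul0r.
have -> : \sum_(x <- l) term3 g x = \sum_(x <- l) \sum_(y <- l) kernel3 g x y.
  by apply: eq_bigr => x _; rewrite /term3 ll// => y; exact: kernel3_0.
have -> : \sum_(x <- l) term1 g x = \sum_(x <- l) dminus g x * \sum_(y <- l) kernel1 g x y.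
  by apply: eq_bigr => x _; rewrite /term1 ll// => y; exact: kernel1_0.
rewrite /kernel3 /kernel1 /interaction /dminus2 /dminus.
(* The sums become variables, so that [ring] sees only the relation [e] between them. *)
move: (\sum_(i <- l) (h _ - h _)) (\sum_(i <- l) \sum_(j <- l) offdiag _ _ (_ * _ * _))
  (\sum_(i <- l) \sum_(j <- l) _ ^+ 2) (\sum_(i <- l) \sum_(j <- l) offdiag _ _ (_ * (_ * _)))
  (\sum_(i <- l) _ * _) => B S3 D E S1 e.
have -> : D + E = B ^+ 2 + S3 - 2 * S1 by rewrite e; ring.
ring.
Qed.

(** * Integrability and integration of the pointwise identity *)

Let cAB : R := cA + 2 * M.

Let A_le g : `|int_dplus g| <= cAB * (1 + N g).
Proof.
rewrite (le_trans (int_dplus_le g))// -/cA /cAB mulrDr mulr1 -addrA lerDl.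
by rewrite addr_ge0 ?mulr_ge0 ?addr_ge0 ?cA_ge0 ?box_count_ge0 ?mulr_ge0.
Qed.

Let B_le g : `|sum_dminus g| <= cAB * (1 + N g).
Proof.
rewrite (le_trans (sum_dminus_le g))// ler_pM ?mulr_ge0 ?box_count_ge0//.
  by rewrite /cAB lerDr cA_ge0.
by rewrite lerDr.
Qed.

Lemma coercivity_cylinder :
  (\int[mu]_g (generatorH z phi F g ^+ 2) =
  \int[mu]_g
   (op_trace g (op_comp g (Dminus2 F g) (op_adjoint (Dminus2 F g)))
   + ssum [set xy : X * X | [/\ config_set g xy.1, config_set g xy.2 & xy.1 != xy.2]]
       (fun xy => (expeR (phi (xy.1 - xy.2)%R) - 1)
          * ((F (config_del g [set xy.1; xy.2]) - F (config_del g [set xy.1]))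
           * (F (config_del g [set xy.1; xy.2]) - F (config_del g [set xy.2])))%R%:E)))%E.
Proof.
(* A product of two functions of linear growth in the count is controlled by its second moment. The
   factor 2 leaves room for the difference A - B. *)
have int2 (u v : config R d -> R) : measurable_fun setT u -> measurable_fun setT v ->
    (forall g, `|u g| <= 2 * cAB * (1 + N g)) -> (forall g, `|v g| <= 2 * cAB * (1 + N g)) ->
    mu.-integrable setT (fun g => (u g * v g)%:E).
  move=> mu0 mv0 ub vb.
  apply: (integrable_le_box_count2 d_gt0 phi_meas phi_ge0 z_ge0 mu_gibbs (c := (2 * cAB) ^+ 2)).
    exact: measurable_funM.
  by move=> g; rewrite -exprMn expr2 normrM ler_pM.
have cAB0 g : 0 <= cAB * (1 + N g) by exact: le_trans (A_le g).
have A2 g : `|int_dplus g| <= 2 * cAB * (1 + N g) by have := A_le g; have := cAB0 g; lra.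
have B2 g : `|sum_dminus g| <= 2 * cAB * (1 + N g) by have := B_le g; have := cAB0 g; lra.
have mA := measurable_int_dplus; have mB := measurable_sum_dminus.
have iL : mu.-integrable setT (fun g => ((int_dplus g - sum_dminus g) ^+ 2)%:E).
  apply: int2; [exact: measurable_funB|exact: measurable_funB|..] => g;
  by have := ler_normB (int_dplus g) (sum_dminus g); have := A_le g; have := B_le g; lra.
have iA : mu.-integrable setT (fun g => (int_dplus g ^+ 2)%:E) by exact: int2.
have iAB : mu.-integrable setT (fun g => (int_dplus g * sum_dminus g)%:E) by exact: int2.
have [i1 E1] := expectation_term1; have [i3 E3] := expectation_term3.
under eq_integral do rewrite generatorHE -EFin_expe.
under [RHS]eq_integral do rewrite coercivity_pointwise.
have fin (u : config R d -> R) : mu.-integrable setT (fun g => (u g)%:E) ->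
    (\int[mu]_g (u g)%:E)%E \is a fin_num by move=> /integrable_fin_num; apply.
have iD3 := integrableB measurableT i3 iA.
have iD1 := integrableB measurableT iAB i1.
pose D3 g : \bar R := ((\sum_(x \in config_set g) term3 g x)%:E - (int_dplus g ^+ 2)%:E)%E.
pose D1 g : \bar R :=
  ((int_dplus g * sum_dminus g)%:E - (\sum_(x \in config_set g) term1 g x)%:E)%E.
have D30 : (\int[mu]_g D3 g = 0)%E.
  by rewrite /D3 (integralB measurableT i3 iA) E3 subee// fin.
have D10 : (\int[mu]_g D1 g = 0)%E.
  by rewrite /D1 (integralB measurableT iAB i1) E1 subee// fin.
(* The mean-zero groups are inserted on the side of (HF)^2, where linearity removes them again. *)
transitivity (\int[mu]_g (((int_dplus g - sum_dminus g) ^+ 2)%:E + D3 g + 2%:E * D1 g))%E.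
  rewrite (integralD measurableT (integrableD measurableT iL iD3)
    (integrableZl measurableT 2 iD1)).
  rewrite (integralD measurableT iL iD3) (integralZl measurableT iD1).
  by rewrite D30 D10 mule0 !adde0.
by apply: eq_integral.
Qed.

End cylinder.

Local Open Scope ereal_scope.

Theorem lemma5p1 (R : realType) (d : nat) (hd : (0 < d)%N)
    (phi : 'rV[R]_d -> \bar R) (hphi : pair_potential phi)
    (phi_ge0 : forall x, 0 <= phi x)
    (phi_int : \int[lebesgue_rV d]_x `|1 - expeR (- phi x)| < +oo)
    (z : R) (hz : (0 < z)%R)
    (mu : probability (config R d) R) (hmu : gibbs z phi mu)
    (F : config R d -> R) (hF : FCb_infty F) :
  \int[mu]_g (generatorH z phi F g ^+ 2) =
  \int[mu]_g
    (op_trace g (op_comp g (Dminus2 F g) (op_adjoint (Dminus2 F g)))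
     + ssum [set xy : 'rV[R]_d * 'rV[R]_d | [/\ config_set g xy.1, config_set g xy.2 & xy.1 != xy.2]]
         (fun xy => (expeR (phi (xy.1 - xy.2)%R) - 1)
            * ((F (config_del g [set xy.1; xy.2]) - F (config_del g [set xy.1]))
             * (F (config_del g [set xy.1; xy.2]) - F (config_del g [set xy.2])))%R%:E)).
Proof.
have [phi_meas _ _ phi_fin] := hphi.
have [n [h [f [_ hC ft ->]]]] := hF.
(* The empty list of derivatives gives continuity and a bound for [h] itself. *)
have [hc _ [M hM]] := hC [::].
have /choice[r0 fr0] := fun i => test_function_support (ft i).
(* A common support radius: the sum of absolute values dominates every [r0 i]. *)
pose r := (\sum_i `|r0 i|)%R.
have fr i x : (r < `|x|)%R -> f i x = 0%R.
  move=> rx; apply: fr0; apply: le_lt_trans rx; apply: le_trans (ler_norm _) _.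
  by rewrite /r (bigD1 i)//= lerDl sumr_ge0.
exact: (coercivity_cylinder hd phi_meas phi_ge0 phi_fin (ltW hz) hmu hc hM ft fr).
Qed.
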